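(* Let $d\in\mathbb{N}$ and $\tau\ge d+1$. There is a threshold $n(d,\tau)$ such that for all $n\ge n(d,\tau)$ and all $\boldsymbol{p}\in\mathscr{P}_\tau$ the following holds. Let $\boldsymbol{K}\sim\mathrm{Multinomial}(n,\boldsymbol{p})$ and let $\boldsymbol{Y}\sim\mathrm{Normal}_d(n\boldsymbol{p},n\Sigma_{\boldsymbol{p}})$ be defined on a probability space $\Omega$. Let $F$ be the cumulative distribution function of $\boldsymbol{\delta}_{\boldsymbol{K},\boldsymbol{p}}^\top\Sigma_{\boldsymbol{p}}^{-1}\boldsymbol{\delta}_{\boldsymbol{K},\boldsymbol{p}}$, let $F^\star(q):=\inf\{x\in\mathbb{R}:F(x)\ge q\}$ be the associated quantile function, let $G$ be the cumulative distribution function of $\boldsymbol{\delta}_{\boldsymbol{Y},\boldsymbol{p}}^\top\Sigma_{\boldsymbol{p}}^{-1}\boldsymbol{\delta}_{\boldsymbol{Y},\boldsymbol{p}}$, and define the random variable $$\Xi_{n,\boldsymbol{p}}:=F^\star\left\{G\left(\boldsymbol{\delta}_{\boldsymbol{Y},\boldsymbol{p}}^\top\Sigma_{\boldsymbol{p}}^{-1}\boldsymbol{\delta}_{\boldsymbol{Y},\boldsymbol{p}}\right)\right\}.$$ For $\ell>0$ let $$c(\ell):=\ell-\frac{1.26\,\tau^3(d+1)(\log n)^{3/2}}{G'(\ell)\,n^{1/2}},\qquad G'(\ell)=\frac{(\ell/2)^{d/2-1}e^{-\ell/2}}{2\,\Gamma(d/2)},$$ and define the event $$A:=\left\{\omega\in\Omega:2(d/2-1)\le\boldsymbol{\delta}_{\boldsymbol{Y}(\omega),\boldsymbol{p}}^\top\Sigma_{\boldsymbol{p}}^{-1}\boldsymbol{\delta}_{\boldsymbol{Y}(\omega),\boldsymbol{p}}\le\sup_{\ell\in[2(d/2-1),\infty),\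 \ell>0}c(\ell)\right\}.$$ Then $$\Xi_{n,\boldsymbol{p}}(\omega)\le\boldsymbol{\delta}_{\boldsymbol{Y}(\omega),\boldsymbol{p}}^\top\Sigma_{\boldsymbol{p}}^{-1}\boldsymbol{\delta}_{\boldsymbol{Y}(\omega),\boldsymbol{p}}+\frac{1.26\,\tau^3(d+1)(\log n)^{3/2}}{G'\{L_{n,\boldsymbol{p},d,\tau}(\omega)\}\,n^{1/2}},\qquad\omega\in A,$$ where $L_{n,\boldsymbol{p},d,\tau}(\omega)$ solves $\boldsymbol{\delta}_{\boldsymbol{Y}(\omega),\boldsymbol{p}}^\top\Sigma_{\boldsymbol{p}}^{-1}\boldsymbol{\delta}_{\boldsymbol{Y}(\omega),\boldsymbol{p}}=c\{L_{n,\boldsymbol{p},d,\tau}(\omega)\}$.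
   Context: $\mathcal{S}_d=\{\boldsymbol{s}\in[0,1]^d:\sum_{i=1}^d s_i\le1\}$, $\mathcal{S}_d^o=\{\boldsymbol{s}\in(0,1)^d:\sum_{i=1}^d s_i<1\}$, and $s_{d+1}:=1-\sum_{i=1}^d s_i$ for $\boldsymbol{s}\in\mathcal{S}_d$. $\mathscr{P}_\tau:=\{\boldsymbol{s}\in\mathcal{S}_d^o:\max_{1\le i\le d+1}s_i^{-1}\le\tau\}$. $\mathrm{Multinomial}(n,\boldsymbol{p})$ is the distribution on $\mathbb{N}_0^d\cap n\mathcal{S}_d$ (first $d$ of $d+1$ category counts) with mass function $P_{n,\boldsymbol{p}}(\boldsymbol{k})=\frac{n!}{\prod_{i=1}^{d+1}k_i!}\prod_{i=1}^{d+1}p_i^{k_i}$, where $k_{d+1}:=n-\sum_{i=1}^dk_i$ and $p_{d+1}:=1-\sum_{i=1}^dp_i$. $\Sigma_{\boldsymbol{p}}:=\mathrm{diag}(\boldsymbol{p})-\boldsymbol{p}\boldsymbol{p}^\top$; for $\boldsymbol{y}\in\mathbb{R}^d$, $\boldsymbol{\delta}_{\boldsymbol{y},\boldsymbol{p}}:=\frac{1}{\sqrt n}(\boldsymbol{y}-n\boldsymbol{p})$. The variable $\boldsymbol{\delta}_{\boldsymbol{Y},\boldsymbol{p}}^\top\Sigma_{\boldsymbol{p}}^{-1}\boldsymbol{\delta}_{\boldsymbol{Y},\boldsymbol{p}}$ has the $\chi^2_d$ distribution, so $G(\ell)=\frac{1}{\Gamma(d/2)}\int_0^{\ell/2}t^{d/2-1}e^{-t}\,dt$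 for $\ell>0$. *)

(* Defs.v *)
From HB Require Import structures.
From mathcomp Require Import all_boot all_order all_algebra.
From mathcomp Require Import all_classical all_reals all_analysis.
From mathcomp Require Import measurable_realfun.

Set Implicit Arguments.
Unset Strict Implicit.
Unset Printing Implicit Defensive.

Import Order.TTheory GRing.Theory Num.Theory.
Import numFieldNormedType.Exports.

Local Open Scope classical_set_scope.
Local Open Scope ring_scope.

Section probability_vectors.
Context {R : realType} {d : nat}.

(* s_1, ..., s_d followed by s_{d+1} := 1 - (s_1 + ... + s_d) *)
Definition full_coord (s : 'cV[R]_d) (i : 'I_d.+1) : R :=
  if unlift ord_max i is Some j then s j 0 else 1 - \sum_(j < d) s j 0.

Definition open_simplex : set 'cV[R]_d :=
  [set s | (forall i, 0 < s i 0 < 1) /\ \sum_(i < d) s i 0 < 1].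

(* All the inverses are positive on the open simplex, so the default value 0
   of the iterated maximum is harmless. *)
Definition Ptau (tau : R) : set 'cV[R]_d :=
  [set s | open_simplex s /\
    \big[Num.max/0]_(i < d.+1) (full_coord s i)^-1 <= tau].

Definition Sigma (p : 'cV[R]_d) : 'M[R]_d := diag_mx p^T - p *m p^T.

Definition delta (n : nat) (p y : 'cV[R]_d) : 'cV[R]_d :=
  (Num.sqrt n%:R)^-1 *: (y - n%:R *: p).

Definition pearson (n : nat) (p y : 'cV[R]_d) : R :=
  ((delta n p y)^T *m invmx (Sigma p) *m delta n p y) 0 0.

Definition col_of_tuple (t : d.-tuple R) : 'cV[R]_d := \col_i tnth t i.

Definition natr_tuple (k : d.-tuple nat) : d.-tuple R :=
  [tuple (tnth k i)%:R | i < d].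

Definition pearson_tuple (n : nat) (p : 'cV[R]_d) (t : d.-tuple R) : R :=
  pearson n p (col_of_tuple t).

Lemma measurable_pearson_tuple n p :
  measurable_fun [set: d.-tuple R] (pearson_tuple n p).
Proof.
have mdelta i : measurable_fun [set: d.-tuple R]
    (fun t => delta n p (col_of_tuple t) i 0).
  rewrite (_ : (fun t => _) = (fun t : d.-tuple R =>
      (Num.sqrt n%:R)^-1 * (tnth t i - n%:R * p i 0))); last first.
    by apply/funext => t; rewrite /delta !mxE.
  apply: measurable_funM => //; apply: measurable_funB => //.
  exact: measurable_tnth.
rewrite (_ : pearson_tuple n p = (fun t : d.-tuple R => \sum_(j < d)
    (\sum_(i < d) delta n p (col_of_tuple t) i 0 * invmx (Sigma p) i j)
     * delta n p (col_of_tuple t) j 0)); last first.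
  apply/funext => t; rewrite /pearson_tuple /pearson mxE.
  apply: eq_bigr => j _; congr (_ * _).
  by rewrite mxE; apply: eq_bigr => i _; rewrite [X in X * _ = _]mxE.
apply: measurable_sum => j; apply: measurable_funM; last exact: mdelta.
by apply: measurable_sum => i; apply: measurable_funM.
Qed.

HB.instance Definition _ n p := isMeasurableFun.Build _ _ _ _
  (pearson_tuple n p) (measurable_pearson_tuple n p).

Lemma measurable_natr_tuple : measurable_fun [set: d.-tuple nat] natr_tuple.
Proof.
apply/measurable_fun_tnthP => i.
rewrite (_ : _ \o _ = (fun m : nat => m%:R) \o (fun k : d.-tuple nat => tnth k i)).
  by apply: measurableT_comp => //; exact: measurable_tnth.
by apply/funext => k /=; rewrite tnth_mktuple.
Qed.

HB.instance Definition _ := isMeasurableFun.Build _ _ _ _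
  natr_tuple measurable_natr_tuple.

(* The last count n - (k_1 + ... + k_d) is a truncated subtraction, only used
   below when k_1 + ... + k_d <= n. *)
Definition full_count (n : nat) (k : d.-tuple nat) (i : 'I_d.+1) : nat :=
  if unlift ord_max i is Some j then tnth k j else (n - \sum_(j < d) tnth k j)%N.

Definition multinomial_pmf (n : nat) (p : 'cV[R]_d) (k : d.-tuple nat) : R :=
  if (\sum_(j < d) tnth k j <= n)%N then
    n`!%:R / (\prod_(i < d.+1) ((full_count n k i)`!)%:R)
    * \prod_(i < d.+1) full_coord p i ^+ full_count n k i
  else 0.

Definition mvnormal_pdf (mu : 'cV[R]_d) (S : 'M[R]_d) (y : 'cV[R]_d) : R :=
  expR (- (2^-1 * ((y - mu)^T *m invmx S *m (y - mu)) 0 0))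
  / Num.sqrt ((2 * pi) ^+ d * \det S).

End probability_vectors.

(* Integral over R^m of a nonnegative measurable function against Lebesgue
   measure, as an iterated integral (Tonelli). *)
Fixpoint iter_integral {R : realType} (m : nat) :
    (m.-tuple R -> \bar R) -> \bar R :=
  match m with
  | 0 => fun f => f [tuple]
  | m'.+1 => fun f => (\int[lebesgue_measure]_x
      iter_integral (fun v : m'.-tuple R => f [tuple of x :: v]))%E
  end.

Section distributions.
Context {R : realType} {d : nat} {disp : measure_display}.
Context {Omega : measurableType disp} (P : probability Omega R).

Definition is_multinomial (n : nat) (p : 'cV[R]_d)
    (K : {RV P >-> d.-tuple nat}) : Prop :=
  forall k : d.-tuple nat,
    distribution P K [set k] = (multinomial_pmf n p k)%:E.

(* d.-tuple R carries the product sigma-algebra, i.e. the Borel sets of R^d. *)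
Definition is_mvnormal (mu : 'cV[R]_d) (S : 'M[R]_d)
    (Y : {RV P >-> d.-tuple R}) : Prop :=
  forall B : set (d.-tuple R), measurable B ->
    distribution P Y B = iter_integral (fun y : d.-tuple R =>
      (\1_B y * mvnormal_pdf mu S (col_of_tuple y))%:E).

Definition pearson_RV (n : nat) (p : 'cV[R]_d) (Y : {RV P >-> d.-tuple R}) :
  {RV P >-> R} := pearson_tuple n p \o Y.

Definition count_RV (K : {RV P >-> d.-tuple nat}) : {RV P >-> d.-tuple R} :=
  natr_tuple \o K.

End distributions.

Section quantile_coupling.
Context {R : realType}.

(* Extended-real valued, so that quantile F 0 = -oo. *)
Definition quantile (F : R -> \bar R) (q : \bar R) : \bar R :=
  ereal_inf [set x%:E | x in [set x | (q <= F x)%E]].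

Definition Gamma (a : R) : R :=
  \int[lebesgue_measure]_(t in `]0, +oo[) (t `^ (a - 1) * expR (- t)).

(* Density of the chi-squared distribution with d degrees of freedom, l > 0. *)
Definition chi2_pdf (d : nat) (l : R) : R :=
  (l / 2) `^ (d%:R / 2 - 1) * expR (- (l / 2)) / (2 * Gamma (d%:R / 2)).

Definition error_term (d : nat) (tau : R) (n : nat) (l : R) : R :=
  (126 / 100) * tau ^+ 3 * d.+1%:R * ln n%:R `^ (3 / 2)
  / (chi2_pdf d l * Num.sqrt n%:R).

Definition c_fun (d : nat) (tau : R) (n : nat) (l : R) : R :=
  l - error_term d tau n l.

End quantile_coupling.

(* Main.v *)
Require Import Defs.
From HB Require Import structures.
From mathcomp Require Import all_boot all_order all_algebra.
From mathcomp Require Import all_classical all_reals all_analysis.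
From mathcomp Require Import measurable_realfun ring lra.
Import Order.TTheory GRing.Theory Num.Theory.
Import numFieldNormedType.Exports.
Local Open Scope classical_set_scope.
Local Open Scope ring_scope.

(** Let [a] be the constant for which the error term at [l] is [a / G'(l)]. If
    [y = c(L)], then the bound claimed for [F^* (G y)] is [y + a / G'(L) = L], so
    the claim says that [G y <= F L]. The density [G'] decreases beyond its mode
    [d - 2], so [G] is concave there and
      [G y <= G L - G'(L) (L - y) = G L - a]
    ([chi2_cdf_concave]). Everything therefore rests on a one-sided Kolmogorov
    bound [G L - F L <= a], uniform in [L] and in the parameter [p]. The bound
    proved here is of order [sqrt (tau / n)]
    ([chi2_cdf_le_multinomial_cdf]); the factor [(log n)^(3/2)] of [a] absorbs
    its constant once [n] is large ([threshold]).

    The function [G] is obtained by completing the square one coordinate at a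
    time in the Pearson form, eliminating the coordinates by affine changes of
    variable ([iter_integral_residual_form]). What remains is the integral of
    [exp (- |z|^2 / 2)] over a ball. On a thin spherical shell this weight is
    nearly constant and the volume is the increment of a multiple of
    [l^(d/2)], which gives [G'] up to a factor ([chi2_cdf_slab]); that factor is
    found by integrating [G'] to 1 ([Gamma_chi2_cst]).

    The Kolmogorov bound compares the normal density with multinomial masses.
    Stirling's formula, with a constant known to be at most [sqrt (2 pi)],
    bounds the mass of a lattice point [k] from below by the normal density at
    [k] times [1 - O(sqrt (tau / n) (1 + Q^2))], where [Q] is the Pearson form
    ([multinomial_pmf_ge]). On the unit cell of [k] the value of [Q] differs
    little from its value at [k], and half of the Gaussian exponent pays for the
    polynomial factor and for the region where [k] is too far from its mean.
    The outcome is a pointwise inequality on the whole space,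
      density [<=] mass of the cell [+ C sqrt (tau / n) c exp (- Q / 4)]
    ([density_le_cells]), whose integral over an ellipsoid is the required bound,
    except that the cells meeting the ellipsoid [Q <= L'] have their corners in
    a slightly larger one, [Q <= L]. The shell in between carries a mass
    proportional to its width ([chi2_cdf_shell_le]). *)

Set Implicit Arguments.
Unset Strict Implicit.
Unset Printing Implicit Defensive.

(** * Iterated Lebesgue integrals *)

Section iterated_integral.
Context {R : realType}.
Local Open Scope ereal_scope.
Implicit Types (m : nat).

Lemma iter_integral_ge0 m (f : m.-tuple R -> \bar R) :
  (forall v, 0 <= f v) -> 0 <= iter_integral f.
Proof.
elim: m f => [|m IH] f f0 //=.
by apply: integral_ge0 => x _; exact: IH.
Qed.

(** The parameter space is arbitrary so that the induction can move each
    variable, once singled out, into the parameters; Tonelli's theorem then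
    applies to that variable. *)
Lemma measurable_iter_integral m d (T : measurableType d)
    (f : T * m.-tuple R -> \bar R) :
  measurable_fun setT f -> (forall z, 0 <= f z) ->
  measurable_fun setT (fun t => iter_integral (fun v => f (t, v))).
Proof.
elim: m d T f => [|m IH] d T f mf f0 /=.
  by apply: measurableT_comp => //; exact: measurable_fun_pair.
pose h := fun z : (T * (m.-tuple R)) * R => f (z.1.1, [the m.+1.-tuple R of z.2 :: z.1.2]).
pose F := fun z : T * R => iter_integral (fun v => f (z.1, [tuple of z.2 :: v])).
have mF : measurable_fun setT F.
  apply: (IH _ _ (fun u : (T * R) * m.-tuple R =>
    f (u.1.1, [tuple of u.1.2 :: u.2]))) => //.
  apply: measurableT_comp => //; apply: measurable_fun_pair.
    by apply: measurableT_comp.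
  apply: measurable_cons => //.
  by apply: measurableT_comp.
apply: (measurable_fun_fubini_tonelli_F (m2 := lebesgue_measure) F) => //.
by move=> z; apply: iter_integral_ge0.
Qed.

Lemma measurable_iter_integral_cons m (f : m.+1.-tuple R -> \bar R) :
  measurable_fun setT f -> (forall v, 0 <= f v) ->
  measurable_fun setT
    (fun x : R => iter_integral (fun v : m.-tuple R => f [tuple of x :: v])).
Proof.
move=> mf f0; apply: (@measurable_iter_integral _ _ _
  (fun z : R * m.-tuple R => f [tuple of z.1 :: z.2])) => //.
by apply: measurableT_comp => //; exact: measurable_cons.
Qed.

Lemma measurable_fun_cons m (f : m.+1.-tuple R -> \bar R) (x : R) :
  measurable_fun setT f ->
  measurable_fun setT (fun v : m.-tuple R => f [tuple of x :: v]).
Proof.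
by move=> mf; apply: measurableT_comp => //; exact: measurable_cons.
Qed.

Lemma le_iter_integral m (f g : m.-tuple R -> \bar R) :
  measurable_fun setT f -> measurable_fun setT g -> (forall v, 0 <= f v) ->
  (forall v, f v <= g v) -> iter_integral f <= iter_integral g.
Proof.
elim: m f g => [|m IH] f g mf mg f0 fg //=.
have g0 v : 0 <= g v by exact: le_trans (fg v).
apply: ge0_le_integral => //.
- by move=> x _; exact: iter_integral_ge0.
- exact: measurable_iter_integral_cons.
- exact: measurable_iter_integral_cons.
- by move=> x _; apply: IH => //; exact: measurable_fun_cons.
Qed.

Lemma iter_integralD m (f g : m.-tuple R -> \bar R) :
  measurable_fun setT f -> measurable_fun setT g ->
  (forall v, 0 <= f v) -> (forall v, 0 <= g v) ->
  iter_integral (fun v => f v + g v) = iter_integral f + iter_integral g.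
Proof.
elim: m f g => [|m IH] f g mf mg f0 g0 //=.
rewrite -ge0_integralD//.
- apply: eq_integral => x _; apply: IH => //; exact: measurable_fun_cons.
- by move=> x _; exact: iter_integral_ge0.
- exact: measurable_iter_integral_cons.
- by move=> x _; exact: iter_integral_ge0.
- exact: measurable_iter_integral_cons.
Qed.

Lemma iter_integralZl m (k : \bar R) (f : m.-tuple R -> \bar R) :
  measurable_fun setT f -> (forall v, 0 <= f v) -> 0 <= k ->
  iter_integral (fun v => k * f v) = k * iter_integral f.
Proof.
move=> + + k0; elim: m f => [|m IH] f mf f0 //=.
rewrite -ge0_integralZl//.
- by apply: eq_integral => x _; apply: IH => //; exact: measurable_fun_cons.
- exact: measurable_iter_integral_cons.
- by move=> x _; exact: iter_integral_ge0.
Qed.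

Lemma iter_integral0 m : iter_integral (fun _ : m.-tuple R => 0) = 0.
Proof. by elim: m => [|m IH] //=; rewrite IH integral0. Qed.

Lemma iter_integral_sum m (I : Type) (s : seq I) (f : I -> m.-tuple R -> \bar R) :
  (forall i, measurable_fun setT (f i)) -> (forall i v, 0 <= f i v) ->
  iter_integral (fun v => \sum_(i <- s) f i v) =
  \sum_(i <- s) iter_integral (f i).
Proof.
move=> mf f0; elim: s => [|i s IH].
  by rewrite big_nil; under [X in iter_integral X]eq_fun do rewrite big_nil;
     exact: iter_integral0.
rewrite big_cons -IH -iter_integralD//.
- by congr iter_integral; apply/funext => v; rewrite big_cons.
- exact: emeasurable_sum.
- by move=> v; exact: sume_ge0.
Qed.

(** The image of Lebesgue measure and a multiple of it agree on half-open
    intervals, hence on all Borel sets. The integrand is merely measurable: the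
    indicator of an ellipsoid has to be allowed. *)
Lemma integral_affine (a b : R) (f : R -> \bar R) : (0 < a)%R ->
  measurable_fun setT f -> (forall x, 0 <= f x) ->
  \int[lebesgue_measure]_x f x =
  a%:E * \int[lebesgue_measure]_x f (a * x + b)%R.
Proof.
move=> a0 mf f0.
pose phi : measurableTypeR R -> measurableTypeR R := fun x => (a * x + b)%R.
have mphi : measurable_fun setT phi.
  by apply: measurable_funD => //; exact: measurable_funM.
rewrite -[X in _ * X](_ : \int[pushforward lebesgue_measure phi]_y f y = _); last first.
  by rewrite ge0_integral_pushforward.
have aE : a = (NngNum (ltW a0))%:num by [].
rewrite [in a%:E]aE -ge0_integral_mscale//.
apply: eq_measure_integral => A mA _.
apply: lebesgue_measure_unique => // X [[x y] /= xy <-].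
rewrite /mscale /pushforward /=.
rewrite [X in _ = _ * lebesgue_measure X](_ :
  _ = `]((x - b) / a)%R, ((y - b) / a)%R]%classic); last first.
  apply/seteqP; split=> z /=; rewrite !in_itv/= ltr_pdivrMr// ler_pdivlMr//;
    by rewrite ltrBlDr lerBrDr ![(z * a)%R]mulrC.
rewrite !lebesgue_measure_itv/= !lte_fin ltr_pM2r ?invr_gt0// ltrD2r.
case: ifPn => _; last by rewrite mule0.
rewrite -!EFinB -EFinM -mulrBl mulrCA mulfV ?gt_eqF// mulr1.
congr (_%:E); lra.
Qed.

End iterated_integral.

(** * Diagonalising the Pearson quadratic form *)

Section residual_form.
Context {R : realType}.
Implicit Types (w : seq (R * R)) (t r : R) (m : nat).

(** For [w = [:: (mu_1, q_1); ...]] this is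
      [sum_i (x_i - mu_i)^2 / q_i + (t + sum_i (x_i - mu_i))^2 / r],
    the Pearson form with the last category eliminated. The deviation
    accumulated by the first coordinates is kept in [t], so that fixing one
    coordinate leaves a form of the same kind in the others. *)
Fixpoint residual_form w (x : seq R) t r : R :=
  match w, x with
  | c :: w', x1 :: x' => (x1 - c.1) ^+ 2 / c.2 + residual_form w' x' (t + (x1 - c.1)) r
  | _, _ => t ^+ 2 / r
  end.

Definition weight_total w r : R := r + \sum_(c <- w) c.2.

(** The determinant of the inverse of the matrix of [residual_form w _ 0 r]. *)
Definition weight_volume w r : R := (\prod_(c <- w) c.2) * r / weight_total w r.

Lemma residual_formE w (x : seq R) t r : size x = size w ->
  residual_form w x t r = \sum_(i < size w) (x`_i - (w`_i).1) ^+ 2 / (w`_i).2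
    + (t + \sum_(i < size w) (x`_i - (w`_i).1)) ^+ 2 / r.
Proof.
elim: w x t => [|c w IH] [|x1 x] t //= sz.
  by rewrite !big_ord0 add0r addr0.
by case: sz => sz; rewrite IH// !big_ord_recl/= !addrA.
Qed.

Definition sqnorm (z : seq R) : R := \sum_(a <- z) a ^+ 2.

Lemma measurable_sqnorm m : measurable_fun [set: m.-tuple R] (fun z : m.-tuple R => sqnorm z).
Proof.
rewrite (_ : (fun x => _) = (fun x : m.-tuple R => \sum_(i < m) tnth x i ^+ 2)).
  by apply: measurable_sum => i; apply: measurable_funX; exact: measurable_tnth.
by apply/funext => x; rewrite /sqnorm big_tuple.
Qed.

Lemma weight_total_cons c w r : weight_total (c :: w) r = c.2 + weight_total w r.
Proof. by rewrite /weight_total big_cons addrCA. Qed.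

Lemma weight_total_gt0 w r : 0 < r -> all (fun c => 0 < c.2) w -> 0 < weight_total w r.
Proof.
move=> r0 w0; rewrite /weight_total ltr_wpDr// big_seq sumr_ge0// => c cw.
by apply/ltW; exact: (allP w0).
Qed.

Lemma weight_volume_gt0 w r : 0 < r -> all (fun c => 0 < c.2) w -> 0 < weight_volume w r.
Proof.
move=> r0 w0; rewrite /weight_volume divr_gt0 ?weight_total_gt0// mulr_gt0//.
by rewrite big_seq prodr_gt0// => c cw; exact: (allP w0).
Qed.

Lemma weight_volume_cons c w r : 0 < c.2 -> 0 < r -> all (fun c => 0 < c.2) w ->
  weight_volume (c :: w) r =
  weight_volume w r * (c.2 * weight_total w r / (c.2 + weight_total w r)).
Proof.
move=> c0 r0 w0; have T0 := weight_total_gt0 r0 w0.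
have T1 : 0 < c.2 + weight_total w r by rewrite addr_gt0.
rewrite /weight_volume weight_total_cons big_cons; field.
by rewrite !gt_eqF.
Qed.

(** [T] is the weight that the form in the first coordinate inherits from
    the coordinates already integrated out. *)
Lemma complete_square (q T t u b : R) : 0 < q -> 0 < T ->
  b = - (q * t / (q + T)) ->
  let x := Num.sqrt (q * T / (q + T)) * u + b in
  x ^+ 2 / q + (t + x) ^+ 2 / T = u ^+ 2 + t ^+ 2 / (q + T).
Proof.
move=> q0 T0 -> /=.
have qT : 0 < q + T by rewrite addr_gt0.
have : Num.sqrt (q * T / (q + T)) ^+ 2 = q * T / (q + T).
  by rewrite sqr_sqrtr// divr_ge0 ?mulr_ge0// ltW.
set s := Num.sqrt _ => sE.
transitivity (s ^+ 2 * u ^+ 2 * (q + T) / (q * T) + t ^+ 2 / (q + T)).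
  by field; rewrite !gt_eqF.
by rewrite sE; field; rewrite !gt_eqF.
Qed.

Local Open Scope ereal_scope.

(** Integrating out all coordinates but the first replaces [r] by the total
    weight of what was removed, so the first coordinate sees a sum of two squares.
    Completing it and rescaling makes this coordinate a standard one. *)
Lemma iter_integral_residual_form m w t r (g : R -> \bar R) :
  size w = m -> all (fun c => 0 < c.2)%R w -> (0 < r)%R ->
  measurable_fun setT g -> (forall s, 0 <= g s) ->
  iter_integral (fun x : m.-tuple R => g (residual_form w x t r)) =
  (Num.sqrt (weight_volume w r))%:E *
  iter_integral (fun z : m.-tuple R => g (sqnorm z + t ^+ 2 / weight_total w r)%R).
Proof.
elim: m w t g => [|m IH] [|c w] t g //= sw w0 r0 mg g0.
  rewrite /weight_volume /weight_total /sqnorm !big_nil addr0 mul1r divff ?gt_eqF//.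
  by rewrite sqrtr1 mul1e add0r.
case: sw => sw; have {w0} /andP[c0 w0] := w0.
have T0 := weight_total_gt0 r0 w0; set T := weight_total w r in T0.
pose h := fun s => iter_integral (fun z : m.-tuple R => g (s + sqnorm z)%R).
have h0 s : 0 <= h s by exact: iter_integral_ge0.
have mh : measurable_fun setT h.
  apply: (@measurable_iter_integral R m _ _
    (fun u : R * m.-tuple R => g (u.1 + sqnorm u.2)%R)) => //.
  apply: measurableT_comp => //; apply: measurable_funD => //.
  by apply: (measurableT_comp (measurable_sqnorm (m := m))).
have mphi : measurable_fun setT
    (fun x : R => h ((x - c.1) ^+ 2 / c.2 + (t + (x - c.1)) ^+ 2 / T)%R).
  have mx : measurable_fun setT (fun x : R => x - c.1)%R.
    by apply: measurable_funB.
  apply: measurableT_comp => //; apply: measurable_funD.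
    by apply: measurable_funM => //; exact: measurable_funX.
  apply: measurable_funM => //; apply: measurable_funX.
  exact: measurable_funD.
transitivity (\int[lebesgue_measure]_x ((Num.sqrt (weight_volume w r))%:E *
    h ((x - c.1) ^+ 2 / c.2 + (t + (x - c.1)) ^+ 2 / T)%R)).
  apply: eq_integral => x _.
  rewrite (IH w (t + (x - c.1))%R (fun s => g ((x - c.1) ^+ 2 / c.2 + s)%R))//; last first.
    by apply: measurableT_comp => //; exact: measurable_funD.
  congr (_ * iter_integral _); apply/funext => z.
  by congr g; rewrite -addrA; congr (_ + _)%R; exact: addrC.
rewrite ge0_integralZl ?lee_fin ?sqrtr_ge0//.
pose k := (c.2 * T / (c.2 + T))%R.
have k0 : (0 < k)%R by rewrite /k; apply: divr_gt0; [exact: mulr_gt0|exact: addr_gt0].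
rewrite (@integral_affine _ (Num.sqrt k) (c.1 - c.2 * t / (c.2 + T))%R)// ?sqrtr_gt0//.
rewrite muleA -EFinM -sqrtrM ?(ltW (weight_volume_gt0 _ _))// -weight_volume_cons//.
congr (_ * _); apply: eq_integral => u _; rewrite -/T /h weight_total_cons -/T.
congr iter_integral; apply/funext => z; congr g.
rewrite addrA addrAC (_ : _ - c.1 = Num.sqrt k * u + - (c.2 * t / (c.2 + T)))%R; last by ring.
rewrite (@complete_square c.2 T t u)// /sqnorm big_cons; ring.
Qed.

End residual_form.

(** * Integrals of radial functions *)

Section radial.
Context {R : realType}.
Implicit Types (m : nat) (g : R -> \bar R).
Local Open Scope ereal_scope.

Definition radial m g : \bar R :=
  iter_integral (fun z : m.-tuple R => g (sqnorm z)).

Lemma measurable_comp_sqnorm m g : measurable_fun setT g ->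
  measurable_fun [set: m.-tuple R] (fun z : m.-tuple R => g (sqnorm z)).
Proof. by move=> mg; apply: measurableT_comp => //; exact: measurable_sqnorm. Qed.

Lemma radialS m g : radial m.+1 g =
  \int[lebesgue_measure]_x radial m (fun s => g (x ^+ 2 + s)%R).
Proof.
apply: eq_integral => x _; congr iter_integral; apply/funext => z.
by rewrite /sqnorm big_cons.
Qed.

Lemma radial_ge0 m g : (forall s, 0 <= g s) -> 0 <= radial m g.
Proof. by move=> g0; exact: iter_integral_ge0. Qed.

Lemma le_radial m g1 g2 : measurable_fun setT g1 -> measurable_fun setT g2 ->
  (forall s, 0 <= g1 s) -> (forall s, (0 <= s)%R -> g1 s <= g2 s) ->
  radial m g1 <= radial m g2.
Proof.
move=> m1 m2 g0 g12; apply: le_iter_integral => //.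
- exact: measurable_comp_sqnorm.
- exact: measurable_comp_sqnorm.
- by move=> z; apply: g12; rewrite /sqnorm sumr_ge0// => i _; exact: sqr_ge0.
Qed.

Lemma radialD m g1 g2 : measurable_fun setT g1 -> measurable_fun setT g2 ->
  (forall s, 0 <= g1 s) -> (forall s, 0 <= g2 s) ->
  radial m (fun s => g1 s + g2 s) = radial m g1 + radial m g2.
Proof.
by move=> m1 m2 g10 g20; apply: iter_integralD => //; exact: measurable_comp_sqnorm.
Qed.

Lemma radialZl m (k : R) g : (0 <= k)%R -> measurable_fun setT g ->
  (forall s, 0 <= g s) ->
  radial m (fun s => k%:E * g s) = k%:E * radial m g.
Proof.
by move=> k0 mg g0; apply: iter_integralZl => //; exact: measurable_comp_sqnorm.
Qed.

Lemma measurable_radial m g : measurable_fun setT g -> (forall s, 0 <= g s) ->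
  measurable_fun setT (fun u : R => radial m (fun s => g (u + s)%R)).
Proof.
move=> mg g0; apply: (@measurable_iter_integral R m _ _
    (fun u : R * m.-tuple R => g (u.1 + sqnorm u.2)%R)) => //.
apply: measurableT_comp => //; apply: measurable_funD => //.
exact: (measurableT_comp (measurable_sqnorm (m := m))).
Qed.

Lemma radial_scale m g (s : R) : (0 < s)%R -> measurable_fun setT g ->
  (forall x, 0 <= g x) ->
  radial m (fun x => g (x / s)%R) = (Num.sqrt s ^+ m)%:E * radial m g.
Proof.
move=> s0; elim: m g => [|m IH] g mg g0.
  by rewrite /radial/= /sqnorm big_nil mul0r mul1e.
rewrite !radialS.
pose h u := radial m (fun x => g (u + x)%R).
have mh : measurable_fun setT h by exact: measurable_radial.
have h0 u : 0 <= h u by exact: radial_ge0.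
transitivity (\int[lebesgue_measure]_x
    ((Num.sqrt s ^+ m)%:E * h (x ^+ 2 / s)%R)).
  apply: eq_integral => x _.
  under [X in radial m X]eq_fun do rewrite mulrDl.
  rewrite (IH (fun y => g (x ^+ 2 / s + y)%R))//.
  by apply: measurableT_comp => //; exact: measurable_funD.
have mhx : measurable_fun setT (fun x : R => h (x ^+ 2 / s)%R).
  by apply: measurableT_comp => //; apply: measurable_funM => //; exact: measurable_funX.
rewrite ge0_integralZl ?lee_fin ?exprn_ge0 ?sqrtr_ge0//.
rewrite [in LHS](@integral_affine _ (Num.sqrt s) 0%R)// ?sqrtr_gt0//.
rewrite muleA -EFinM -exprSr; congr (_ * _); apply: eq_integral => u _.
by rewrite addr0 exprMn sqr_sqrtr ?ltW// mulrAC mulfV ?gt_eqF// mul1r.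
Qed.

Lemma measurable_expRN (a : R) :
  measurable_fun setT (fun s : R => (expR (- (s / a)))%:E).
Proof.
apply/measurable_EFinP; apply: measurableT_comp => //.
by apply: measurableT_comp => //; exact: measurable_funM.
Qed.

(** [gauss_fun] has weight [exp (- x^2)], hence the change of scale. *)
Lemma integral_gauss_half :
  \int[lebesgue_measure]_x (expR (- (x ^+ 2 / 2)) : R)%:E = (Num.sqrt (2 * pi))%:E.
Proof.
rewrite (@integral_affine _ (Num.sqrt 2) 0%R)// ?sqrtr_gt0//; last first.
  apply/measurable_EFinP; apply: measurableT_comp => //.
  by apply: measurableT_comp => //; apply: measurable_funM => //; exact: measurable_funX.
rewrite sqrtrM// EFinM -integralT_gauss; congr (_ * _).
apply: eq_integral => x _; rewrite /gauss_fun addr0 exprMn sqr_sqrtr//.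
by rewrite mulrAC mulfV// mul1r.
Qed.

Lemma radial_expR m :
  radial m (fun s => (expR (- (s / 2)))%:E) = (Num.sqrt (2 * pi) ^+ m)%:E.
Proof.
elim: m => [|m IH].
  by rewrite /radial/= /sqnorm big_nil mul0r oppr0 expR0.
rewrite radialS; transitivity (\int[lebesgue_measure]_x
    ((Num.sqrt (2 * pi) ^+ m)%:E * (expR (- (x ^+ 2 / 2)))%:E : \bar R)).
  apply: eq_integral => x _.
  rewrite -IH muleC -radialZl ?expR_ge0//; last exact: measurable_expRN.
  by congr radial; apply/funext => s; rewrite -EFinM -expRD mulrDl opprD.
rewrite ge0_integralZl ?lee_fin ?exprn_ge0 ?sqrtr_ge0//.
- by rewrite integral_gauss_half -EFinM -exprSr.
- apply/measurable_EFinP; apply: measurableT_comp => //.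
  by apply: measurableT_comp => //; apply: measurable_funM => //; exact: measurable_funX.
Qed.

End radial.

(** * The chi-squared distribution *)

(** Replacing the weight by its value at [l] changes the increment
    [f (l + h) - f l] by at most
    [`|e (l + h) - e l| * `|phi (l + h) - phi l|], which is [o(h)]. *)
Lemma is_derive_weighted (R : realType) (f phi e : R -> R) (l dphi : R) :
  0 < l -> is_derive l 1 phi dphi -> {for l, continuous e} ->
  (forall x y, 0 < x -> x <= y ->
     e y * (phi y - phi x) <= f y - f x <= e x * (phi y - phi x)) ->
  is_derive l 1 f (e l * dphi).
Proof.
move=> l0 dp ce H.
pose q (g : R -> R) (h : R) := h^-1 * (g (h + l) - g l).
have qp : q phi h @[h --> 0^'] --> dphi.
  have := @ex_derive _ _ _ _ _ _ _ dp; rewrite /derivable => /cvg_ex[/= a ha].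
  have aE : a = dphi.
    rewrite -(@derive_val _ _ _ _ _ _ _ dp) /derive; apply/esym/cvg_lim => //.
  rewrite -aE; move: ha; apply: cvg_trans; apply: near_eq_cvg; near=> h.
  by rewrite /q /= [h *: 1]mulr1.
have le : e (h + l) - e l @[h --> 0^'] --> 0.
  apply: cvg_within_filter.
  suff : e (h + l) - e l @[h --> 0] --> e l - e l by rewrite subrr.
  apply: cvgB; last exact: cvg_cst.
  apply: (@cvg_comp _ _ _ (fun h => h + l) e _ (nbhs l)) ce.
  suff : h + l @[h --> 0] --> 0 + l by rewrite add0r.
  by apply: cvgD; [exact: cvg_id|exact: cvg_cst].
have err : `|e (h + l) - e l| * `|q phi h| @[h --> 0^'] --> 0.
  suff : `|e (h + l) - e l| * `|q phi h| @[h --> 0^'] --> `|0 : R| * `|dphi|.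
    by rewrite normr0 mul0r.
  by apply: cvgM; exact: cvg_norm.
have qf : q f h @[h --> 0^'] --> e l * dphi.
  apply: (@squeeze_cvgr _ _ _ _ (fun h => e l * q phi h - `|e (h + l) - e l| * `|q phi h|)
     (fun h => e l * q phi h + `|e (h + l) - e l| * `|q phi h|)).
  - near=> h.
    have hl : 0 < h + l.
      rewrite -ltrBlDr sub0r.
      suff : `|h| < l by rewrite ltr_norml => /andP[].
      near: h; apply: dnbhs0_lt => //.
    have h0 : h != 0 by near: h; exact: nbhs_dnbhs_neq.
    have : `|(f (h + l) - f l) - e l * (phi (h + l) - phi l)|
         <= `|e (h + l) - e l| * `|phi (h + l) - phi l|.
      rewrite -normrM.
      have [hge|hlt] := leP l (h + l).
        have /andP[H1 H2] := H _ _ l0 hge.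
        by rewrite [leRHS]ler0_norm 1?[leLHS]ler0_norm; nra.
      have /andP[H1 H2] := H _ _ hl (ltW hlt).
      by rewrite [leRHS]ler0_norm 1?[leLHS]ler0_norm; nra.
    rewrite -(ler_pM2l (_ : 0 < `|h^-1|)) ?normr_gt0 ?invr_eq0//.
    rewrite -normrM mulrCA -normrM -/(q phi h).
    rewrite mulrBr -/(q f h) mulrCA -/(q phi h) ler_distl.
    by [].
  - suff : e l * q phi h - `|e (h + l) - e l| * `|q phi h| @[h --> 0^']
        --> e l * dphi - 0 by rewrite subr0.
    apply: cvgB => //.
    by apply: cvgM => //; exact: cvg_cst.
  - suff : e l * q phi h + `|e (h + l) - e l| * `|q phi h| @[h --> 0^']
        --> e l * dphi + 0 by rewrite addr0.
    apply: cvgD => //.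
    by apply: cvgM => //; exact: cvg_cst.
have qfE : (fun h : R => h^-1 *: ((f \o shift l) (h *: 1) - f l)) = q f.
  by apply/funext => h; rewrite /q /= [h *: 1]mulr1.
split.
  by rewrite /derivable qfE; apply/cvg_ex; exists (e l * dphi).
by rewrite /derive qfE; exact: cvg_lim.
Unshelve. all: by end_near. Qed.

Section chi2.
Context {R : realType}.
Implicit Types (m : nat) (l : R).

Local Notation ray l := (`]-oo, l%R]%classic : set R).
Local Notation slab a b := (`]a%R, b%R]%classic : set R).

Lemma measurable_EFin_indic (A : set R) : measurable A ->
  measurable_fun setT (fun s : R => (\1_A s : R)%:E).
Proof. by move=> mA; apply/measurable_EFinP; exact: measurable_indic. Qed.

Lemma measurable_indic_expRN (A : set R) : measurable A ->
  measurable_fun setT (fun s : R => (\1_A s * expR (- (s / 2)))%:E).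
Proof.
move=> mA; apply/measurable_EFinP; apply: measurable_funM.
  exact: measurable_indic.
by apply/measurable_EFinP; exact: measurable_expRN.
Qed.

Lemma indic_EFin_ge0 (A : set R) (s : R) : (0 <= (\1_A s : R)%:E)%E.
Proof. by rewrite lee_fin. Qed.

Lemma indic_expR_ge0 (A : set R) (s : R) :
  (0 <= (\1_A s * expR (- (s / 2)))%:E)%E.
Proof. by rewrite lee_fin mulr_ge0// expR_ge0. Qed.

Hint Resolve indic_EFin_ge0 indic_expR_ge0 : core.

Lemma radial_indic_expR_le m (A : set R) : measurable A ->
  (radial m (fun s => (\1_A s * expR (- (s / 2)))%:E) <= (Num.sqrt (2 * pi) ^+ m)%:E)%E.
Proof.
move=> mA; rewrite -radial_expR; apply: le_radial => //.
- exact: measurable_indic_expRN.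
- exact: measurable_expRN.
- by move=> s s0; rewrite lee_fin ler_piMl ?expR_ge0.
Qed.

Lemma radial_indic_expR_fin m (A : set R) : measurable A ->
  radial m (fun s => (\1_A s * expR (- (s / 2)))%:E) \is a fin_num.
Proof.
move=> mA; rewrite ge0_fin_numE ?radial_ge0//.
by rewrite (le_lt_trans (radial_indic_expR_le _ _))// ltry.
Qed.

Lemma radial_ball_fin m : radial m (fun s => (\1_(ray 1) s : R)%:E) \is a fin_num.
Proof.
rewrite ge0_fin_numE ?radial_ge0//.
apply: (@le_lt_trans _ _ ((expR 2^-1)%:E * (Num.sqrt (2 * pi) ^+ m)%:E)%E);
  last by rewrite -EFinM ltry.
rewrite -radial_expR -radialZl ?expR_ge0//; last exact: measurable_expRN.
apply: le_radial => //.
- exact: measurable_EFin_indic.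
- by apply: measurable_funeM; exact: measurable_expRN.
- move=> s s0; rewrite -EFinM lee_fin -expRD indicE.
  case: (boolP (_ \in _)) => [|_]; last exact: expR_ge0.
  rewrite inE/= in_itv/= => s1.
  by rewrite /= (le_trans _ (expR_ge1Dx _))//=; lra.
Qed.

Definition ball_vol m : R := fine (radial m (fun s => (\1_(ray 1) s : R)%:E)).

Lemma ball_vol_ge0 m : 0 <= ball_vol m.
Proof. by apply: fine_ge0; exact: radial_ge0. Qed.

Lemma sqrtX_powR m l : 0 <= l -> Num.sqrt l ^+ m = l `^ (m%:R / 2).
Proof.
move=> l0; rewrite -powR12_sqrt// -powR_mulrn ?powR_ge0// -powRrM.
by rewrite mulrC.
Qed.

Lemma radial_ball m l : 0 < l ->
  radial m (fun s => (\1_(ray l) s : R)%:E) = (l `^ (m%:R / 2) * ball_vol m)%:E.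
Proof.
move=> l0; rewrite EFinM fineK ?radial_ball_fin// -sqrtX_powR ?ltW//.
rewrite -radial_scale//; last exact: measurable_EFin_indic.
congr radial; apply/funext => s; rewrite !indicE; congr (_%:R%:E); congr nat_of_bool.
by apply/idP/idP; rewrite !inE/= !in_itv/= ler_pdivrMr// mul1r.
Qed.

Definition gauss_mass m : R := Num.sqrt (2 * pi) ^+ m.

Lemma gauss_mass_gt0 m : 0 < gauss_mass m.
Proof. by rewrite exprn_gt0// sqrtr_gt0 mulr_gt0// pi_gt0. Qed.

Definition chi2_cdf m l : R :=
  fine (radial m (fun s => (\1_(ray l) s * expR (- (s / 2)))%:E)) / gauss_mass m.

(** The factor for which [chi2_cst m * expR (- (l / 2))] times the derivative
    of [l `^ (m / 2)] is the chi-squared density. *)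
Definition chi2_cst m : R := ball_vol m / gauss_mass m.

Lemma chi2_cst_ge0 m : 0 <= chi2_cst m.
Proof. by rewrite divr_ge0 ?ball_vol_ge0// ltW// gauss_mass_gt0. Qed.

Lemma ray_split (x y s : R) : x <= y ->
  \1_(ray y) s = \1_(ray x) s + \1_(slab x y) s :> R.
Proof.
move=> xy; rewrite !indicE !mem_setE !in_itv/=.
by case: (leP s x) => sx /=; [rewrite (le_trans sx xy)/= addr0|rewrite add0r].
Qed.

Lemma radial_slab m x y : 0 < x -> x <= y ->
  radial m (fun s => (\1_(slab x y) s : R)%:E) =
  ((y `^ (m%:R / 2) - x `^ (m%:R / 2)) * ball_vol m)%:E.
Proof.
move=> x0 xy; have := @radial_ball m y (lt_le_trans x0 xy).
under [X in radial _ X]eq_fun do rewrite (ray_split _ xy) EFinD.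
rewrite radialD//; do ?[exact: measurable_EFin_indic].
rewrite radial_ball// mulrBl EFinB => <-.
by rewrite addeAC subee// add0e.
Qed.

Lemma chi2_cdf_diff m x y : x <= y -> chi2_cdf m y - chi2_cdf m x =
  fine (radial m (fun s => (\1_(slab x y) s * expR (- (s / 2)))%:E)) / gauss_mass m.
Proof.
move=> xy; rewrite /chi2_cdf -mulrBl; congr (_ / _).
under [X in fine (radial _ X) - _]eq_fun do rewrite (ray_split _ xy) mulrDl EFinD.
rewrite radialD//; do ?[exact: measurable_indic_expRN].
by rewrite fineD ?radial_indic_expR_fin// addrAC subrr add0r.
Qed.

(** On the shell [x < |z|^2 <= y] the Gaussian weight lies between its values
    on the two bounding spheres, and by homogeneity the volume of the shell is
    the increment of a multiple of [l `^ (m / 2)]. *)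
Lemma chi2_cdf_slab m x y : 0 < x -> x <= y ->
  chi2_cst m * expR (- (y / 2)) * (y `^ (m%:R / 2) - x `^ (m%:R / 2))
  <= chi2_cdf m y - chi2_cdf m x <=
  chi2_cst m * expR (- (x / 2)) * (y `^ (m%:R / 2) - x `^ (m%:R / 2)).
Proof.
move=> x0 xy; rewrite chi2_cdf_diff//.
have E a : chi2_cst m * expR (- (a / 2)) * (y `^ (m%:R / 2) - x `^ (m%:R / 2)) =
    fine (radial m (fun s => ((expR (- (a / 2)))%:E * (\1_(slab x y) s : R)%:E)%E))
     / gauss_mass m.
  rewrite radialZl ?expR_ge0//; last exact: measurable_EFin_indic.
  by rewrite radial_slab//= /chi2_cst; ring.
have F a : radial m (fun s => ((expR (- (a / 2)))%:E * (\1_(slab x y) s : R)%:E)%E)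
    \is a fin_num.
  rewrite radialZl ?expR_ge0//; last exact: measurable_EFin_indic.
  by rewrite radial_slab.
rewrite !E !ler_pM2r ?invr_gt0 ?gauss_mass_gt0// !fine_le ?radial_indic_expR_fin//=.
- apply: le_radial => //; first exact: measurable_indic_expRN.
    by apply: measurable_funeM; exact: measurable_EFin_indic.
  move=> s s0; rewrite -EFinM lee_fin mulrC indicE mem_setE in_itv/=.
  case: (boolP (x < s <= y)) => [/andP[xs sy]|_] /=; rewrite ?mulr0 ?mul0r//.
  rewrite ?mulr1 ?mul1r ler_expR; lra.
- apply: le_radial => //.
  + by apply: measurable_funeM; exact: measurable_EFin_indic.
  + exact: measurable_indic_expRN.
  + move=> s s0; rewrite -EFinM lee_fin mulrC indicE mem_setE in_itv/=.
    case: (boolP (x < s <= y)) => [/andP[xs sy]|_] /=; rewrite ?mulr0 ?mul0r//.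
    by rewrite ?mulr1 ?mul1r ler_expR; lra.
Qed.

Lemma chi2_cdf_ge0 m l : 0 <= chi2_cdf m l.
Proof.
by rewrite divr_ge0 ?(ltW (gauss_mass_gt0 _))// fine_ge0// radial_ge0.
Qed.

Lemma chi2_cdf_nd m x y : x <= y -> chi2_cdf m x <= chi2_cdf m y.
Proof.
move=> xy; rewrite -subr_ge0 chi2_cdf_diff// divr_ge0 ?(ltW (gauss_mass_gt0 _))//.
by apply: fine_ge0; apply: radial_ge0.
Qed.

Lemma chi2_cdf_small m l : 0 < l -> chi2_cdf m l <= chi2_cst m * l `^ (m%:R / 2).
Proof.
move=> l0; rewrite /chi2_cdf /chi2_cst mulrAC ler_pM2r ?invr_gt0 ?gauss_mass_gt0//.
rewrite -lee_fin fineK ?radial_indic_expR_fin// mulrC -radial_ball//.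
apply: le_radial => //.
- exact: measurable_indic_expRN.
- exact: measurable_EFin_indic.
- move=> s s0; rewrite lee_fin ler_piMr// expR_le1; lra.
Qed.

End chi2.

Section chi2_density.
Context {R : realType}.
Variable m : nat.
Implicit Types l : R.

Definition chi2_density l : R :=
  chi2_cst m * expR (- (l / 2)) * (m%:R / 2 * l `^ (m%:R / 2 - 1)).

Lemma continuous_expRN2 : continuous (fun x : R => expR (- (x / 2))).
Proof.
move=> x; apply: continuous_comp; last exact: continuous_expR.
apply: continuousN; apply: continuousM; [exact: cvg_id|exact: cvg_cst].
Qed.

Lemma is_derive_chi2_cdf l : 0 < l ->
  is_derive l 1 (chi2_cdf m) (chi2_density l).
Proof.
move=> l0; apply: (@is_derive_weighted R (chi2_cdf m) (fun x => x `^ (m%:R / 2))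
  (fun x => chi2_cst m * expR (- (x / 2)))) => //.
- exact: is_derive1_powR.
- by apply: cvgM; [exact: cvg_cst|exact: continuous_expRN2].
- by move=> x y x0 xy; exact: chi2_cdf_slab.
Qed.

Lemma chi2_density_ge0 l : 0 <= chi2_density l.
Proof.
apply: mulr_ge0; apply: mulr_ge0; rewrite ?chi2_cst_ge0 ?expR_ge0 ?powR_ge0//.
Qed.

Lemma chi2_density_continuous l : 0 < l -> {for l, continuous chi2_density}.
Proof.
move=> l0; rewrite /chi2_density; apply: cvgM.
  by apply: cvgM; [exact: cvg_cst|exact: continuous_expRN2].
apply: cvgM; first exact: cvg_cst.
have /derivable1_diffP/differentiable_continuous :
  derivable (fun x => x `^ (m%:R / 2 - 1)) l 1 by apply: derivable_powR; rewrite in_itv/= l0.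
exact.
Qed.

Lemma radial_expR_quarter :
  radial m (fun s : R => (expR (- (s / 4)))%:E) = (Num.sqrt 2 ^+ m * gauss_mass m)%:E.
Proof.
under [X in radial _ X]eq_fun => s.
  rewrite (_ : s / 4 = s / 2 / 2); last by field.
  over.
rewrite (@radial_scale R m (fun s : R => (expR (- (s / 2)))%:E) 2)//; last exact: measurable_expRN.
by rewrite radial_expR -EFinM.
Qed.

(** Beyond [l] one half of the exponent is at least [l / 4], and the other half
    still has a finite integral. *)
Lemma chi2_cdf_tail l : 1 - chi2_cdf m l <= Num.sqrt 2 ^+ m * expR (- (l / 4)).
Proof.
have gm0 := @gauss_mass_gt0 R m.
rewrite -(ler_pM2r gm0) mulrBl mul1r /chi2_cdf divfK ?gt_eqF//.
rewrite lerBlDr -lee_fin EFinD fineK ?radial_indic_expR_fin//.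
rewrite mulrAC mulrC EFinM -radial_expR_quarter -radialZl ?expR_ge0//; last exact: measurable_expRN.
have mq : measurable_fun setT (fun s : R => ((expR (- (l / 4)))%:E * (expR (- (s / 4)))%:E)%E).
  by apply: measurable_funeM; exact: measurable_expRN.
rewrite -radialD//; last exact: measurable_indic_expRN.
rewrite -radial_expR; apply: le_radial => //.
- exact: measurable_expRN.
- by apply: emeasurable_funD => //; exact: measurable_indic_expRN.
- move=> s s0; rewrite -EFinM -EFinD lee_fin -expRD indicE mem_setE in_itv/=.
  have [sl|sl] := leP s l; first by rewrite mul1r lerDr expR_ge0.
  by rewrite mul0r addr0 ler_expR; lra.
Qed.

Lemma chi2_cdf_le1 l : chi2_cdf m l <= 1.
Proof.
rewrite /chi2_cdf ler_pdivrMr ?gauss_mass_gt0// mul1r -lee_fin.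
by rewrite fineK ?radial_indic_expR_fin// radial_indic_expR_le.
Qed.

Lemma cvg_chi2_cdfy : chi2_cdf m x @[x --> +oo] --> (1 : R).
Proof.
apply: (@squeeze_cvgr _ _ _ _ (fun x => 1 - Num.sqrt 2 ^+ m * expR (- (x / 4))) (cst 1)).
- near=> x; rewrite chi2_cdf_le1 andbT.
  by have := chi2_cdf_tail x; lra.
- suff : 1 - Num.sqrt 2 ^+ m * expR (- (x / 4)) @[x --> +oo]
      --> 1 - Num.sqrt 2 ^+ m * (0 : R) by rewrite mulr0 subr0.
  apply: cvgB; first exact: cvg_cst.
  apply: cvgM; first exact: cvg_cst.
  apply: (@cvg_comp _ _ _ (fun x : R => x / 4) (fun x : R => expR (- x)) _ (+oo)).
    by apply: gt0_cvgMly => //; exact: cvg_id.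
  exact: cvgr_expR.
- exact: cvg_cst.
Unshelve. all: by end_near. Qed.

Lemma cvg_chi2_cdf0 : (0 < m)%N ->
  chi2_cdf m n.+1%:R^-1 @[n --> \oo] --> (0 : R).
Proof.
move=> m0.
(* For l <= 1 the power l^(m/2) is at most sqrt l. *)
apply: (@squeeze_cvgr _ _ _ _ (cst 0)
  (fun n => chi2_cst m * Num.sqrt (n.+1%:R^-1))).
- near=> n; rewrite chi2_cdf_ge0/=.
  have n0 : (0 : R) < n.+1%:R^-1 by rewrite invr_gt0.
  apply: (le_trans (chi2_cdf_small m n0)).
  rewrite ler_wpM2l ?chi2_cst_ge0// -sqrtX_powR ?(ltW n0)//.
  set q := Num.sqrt _.
  have q0 : 0 <= q by exact: sqrtr_ge0.
  have q1 : q <= 1 by rewrite -sqrtr1 ler_wsqrtr// invf_le1 ?ltr0n// ler1n.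
  by rewrite -(prednK m0) exprS; apply: ler_piMr => //; exact: exprn_ile1.
- exact: cvg_cst.
- suff : chi2_cst m * Num.sqrt (n.+1%:R^-1) @[n --> \oo] --> chi2_cst m * Num.sqrt (0 : R).
    by rewrite sqrtr0 mulr0.
  apply: cvgM; first exact: cvg_cst.
  apply: (@cvg_comp _ _ _ (fun n : nat => n.+1%:R^-1 : R) (@Num.sqrt R) _ (nbhs (0 : R))).
    exact: cvg_harmonic.
  exact: sqrt_continuous.
Unshelve. all: by end_near. Qed.

(** For [m = 1] the density is unbounded at 0, so the fundamental theorem of
    calculus is used from [1 / (n + 1)] to infinity, and then [n] tends to infinity. *)
Lemma integral_chi2_density : (0 < m)%N ->
  (\int[lebesgue_measure]_(x in `]0%R, +oo[) (chi2_density x)%:E)%E = 1%E.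
Proof.
move=> m0.
have E n : (\int[lebesgue_measure]_(x in `[n.+1%:R^-1%R, +oo[) (chi2_density x)%:E
    = (1 - chi2_cdf m n.+1%:R^-1)%R%:E)%E.
  have n0 : (0 : R) < n.+1%:R^-1 by rewrite invr_gt0.
  rewrite EFinB; apply: ge0_continuous_FTC2y.
  - by move=> x _; exact: chi2_density_ge0.
  - apply: continuous_in_subspaceT => x; rewrite inE/= in_itv/= andbT => nx.
    by apply: chi2_density_continuous; exact: lt_le_trans nx.
  - exact: cvg_chi2_cdfy.
  - move=> x nx; apply: ex_derive; apply: is_derive_chi2_cdf; exact: lt_trans nx.
  - apply: cvg_at_right_filter.
    have /@ex_derive/derivable1_diffP/differentiable_continuous := is_derive_chi2_cdf n0.
    exact.
  - move=> x; rewrite in_itv/= andbT => nx; rewrite derive1E.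
    by apply: derive_val; apply: is_derive_chi2_cdf; exact: lt_trans nx.
have U : \bigcup_n `[n.+1%:R^-1, +oo[%classic = `]0, +oo[%classic :> set R.
  apply/seteqP; split => x /=.
    move=> [n _]; rewrite /= !in_itv/= !andbT; apply: lt_le_trans.
    by rewrite invr_gt0.
  rewrite in_itv/= andbT => x0; exists (Num.truncn x^-1) => //=.
  rewrite in_itv/= andbT -[leRHS]invrK lef_pV2 ?posrE ?invr_gt0//.
  by rewrite ltW// truncnS_gt.
have mI (i : interval R) : measurable_fun [set` i] (fun x => (chi2_density x)%:E).
  apply: measurable_funTS; apply/measurable_EFinP.
  rewrite /chi2_density; apply: measurable_funM.
    by apply: measurable_funM => //; apply/measurable_EFinP; exact: measurable_expRN.
  by apply: measurable_funM => //; exact: measurable_powR.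
have := @ge0_nondecreasing_set_cvg_integral _ (measurableTypeR R) R
  (fun n => `[n.+1%:R^-1 : R, +oo[%classic) (fun x => (chi2_density x)%:E)
  lebesgue_measure.
rewrite U => H.
apply: (@cvg_unique _ _ _ _ _ _ (H _ _ _ _)) => //.
- move=> a b ab; apply/subsetPset => x /=; rewrite !in_itv/= !andbT; apply: le_trans.
  by rewrite lef_pV2 ?posrE// ler_nat ltnS.
- by move=> n; exact: mI.
- by move=> n x _; rewrite lee_fin chi2_density_ge0.
- have C : (1 - chi2_cdf m n.+1%:R^-1)%:E @[n --> \oo] --> (1 : R)%:E.
    apply: cvg_EFin; first by near=> n.
    suff : 1 - chi2_cdf m n.+1%:R^-1 @[n --> \oo] --> 1 - (0:R) by rewrite subr0.
    by apply: cvgB; [exact: cvg_cst|exact: cvg_chi2_cdf0].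
  by move: C; apply: cvg_trans; apply: near_eq_cvg; apply: nearW => n; rewrite E.
Unshelve. all: by end_near. Qed.

End chi2_density.

Section chi2_Gamma.
Context {R : realType}.
Variable m : nat.
Hypothesis m0 : (0 < m)%N.

Let s : R := m%:R / 2.
Let K : R := chi2_cst m * s * 2 `^ s.

Let K0 : 0 <= K.
Proof.
by apply: mulr_ge0; [apply: mulr_ge0; [exact: chi2_cst_ge0|exact: divr_ge0]|exact: powR_ge0].
Qed.

Let gamma_integrand (t : R) := t `^ (s - 1) * expR (- t).

Let density_double (t : R) : 0 < t ->
  2 * chi2_density m (2 * t) = K * gamma_integrand t.
Proof.
move=> t0; rewrite /chi2_density /K /gamma_integrand -/s.
rewrite powRM ?ltW// -(@mulr_powRB1 _ 2 s)//; last first.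
  by rewrite /s divr_gt0// ltr0n.
rewrite (_ : 2 * t / 2 = t); last by rewrite mulrAC mulfV// mul1r.
by ring.
Qed.

Let measurable_gamma_integrand D : measurable D ->
  measurable_fun D (fun t => (gamma_integrand t)%:E).
Proof.
move=> mD; apply: measurable_funTS; apply/measurable_EFinP.
apply: measurable_funM; first exact: measurable_powR.
by apply: measurableT_comp => //; exact: measurableT_comp.
Qed.

Let gamma_integral : (K%:E * \int[lebesgue_measure]_(t in `]0%R, +oo[)
  (gamma_integrand t)%:E = 1)%E.
Proof.
rewrite -(integral_chi2_density m0) [RHS]integral_mkcond.
have mf : measurable_fun setT ((fun x => (chi2_density m x)%:E) \_ (`]0%R, +oo[%classic : set R)).
  apply/(measurable_restrictT _ _).1 => //; apply: measurable_funTS; apply/measurable_EFinP.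
  rewrite /chi2_density; apply: measurable_funM.
    by apply: measurable_funM => //; apply/measurable_EFinP; exact: measurable_expRN.
  by apply: measurable_funM => //; exact: measurable_powR.
rewrite (@integral_affine _ 2 0)//; last first.
  by move=> x; apply: erestrict_ge0 => y _; rewrite lee_fin chi2_density_ge0.
rewrite -[LHS]ge0_integralZl//; last 2 first.
- exact: measurable_gamma_integrand.
- by move=> x _; rewrite lee_fin mulr_ge0 ?powR_ge0 ?expR_ge0.
rewrite -[RHS]ge0_integralZl//; last 2 first.
- by apply: measurableT_comp => //; apply: measurable_funD => //; exact: measurable_funM.
- by move=> x _; apply: erestrict_ge0 => y _; rewrite lee_fin chi2_density_ge0.
rewrite integral_mkcond; apply: eq_integral => x _.
rewrite !patchE !mem_setE !in_itv/= !andbT addr0 pmulr_rgt0//.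
by case: ifPn => [x0|_]; rewrite ?mule0// -!EFinM density_double.
Qed.

(** The substitution [l = 2 t] turns the total mass of the density into a
    multiple of the Gamma integral. This also shows that the integral defining
    [Gamma] is finite. *)
Lemma Gamma_chi2_cst : chi2_cst m * (m%:R / 2) * 2 `^ (m%:R / 2) * Gamma (m%:R / 2) = 1 :> R.
Proof.
rewrite -/s -/K /Gamma /Rintegral; move: gamma_integral.
set I := integral _ _ _ => KI.
have I0 : (0 <= I)%E.
  by apply: integral_ge0 => t _; rewrite lee_fin mulr_ge0 ?powR_ge0 ?expR_ge0.
case: I I0 KI => [r _ [Kr]|_|] //=.
have := K0; rewrite le_eqVlt => /orP[/eqP <-|Kgt0].
  by rewrite mul0e => /eqP; rewrite eqe eq_sym oner_eq0.
by rewrite gt0_muley ?lte_fin.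
Qed.

Lemma chi2_cst_gt0 : 0 < chi2_cst m :> R.
Proof.
rewrite lt_neqAle chi2_cst_ge0 andbT; apply/eqP => c0.
have := Gamma_chi2_cst; rewrite -c0 !mul0r => /eqP.
by rewrite eq_sym oner_eq0.
Qed.

Lemma Gamma_half_gt0 : 0 < Gamma (m%:R / 2) :> R.
Proof.
rewrite -/s.
have /lt0r_neq0 c0 := chi2_cst_gt0.
have := ltr01 (R := R); rewrite -{1}Gamma_chi2_cst pmulr_rgt0//.
apply: mulr_gt0; last exact: powR_gt0.
by apply: mulr_gt0; [exact: chi2_cst_gt0|rewrite divr_gt0// ltr0n].
Qed.

Lemma chi2_pdfE (l : R) : 0 < l -> chi2_pdf m l = chi2_density m l.
Proof.
move=> l0; have := Gamma_half_gt0; rewrite /chi2_pdf -/s => G0.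
have -> : chi2_density m l =
    chi2_cst m * s * (l `^ (s - 1) * expR (- (l / 2))).
  by rewrite /chi2_density -/s; ring.
have p0 : 0 < 2 `^ s :> R by rewrite powR_gt0.
have -> : chi2_cst m * s = (2 `^ s * Gamma s)^-1.
  apply: (mulIf (x := 2 `^ s * Gamma s)); first by rewrite mulf_neq0 ?gt_eqF.
  by rewrite mulVf ?mulf_neq0 ?gt_eqF// mulrA Gamma_chi2_cst.
have -> : (l / 2) `^ (s - 1) = l `^ (s - 1) / 2 `^ (s - 1).
  by rewrite powRM ?ltW ?invr_gt0// -powR_inv1// -powRrM mulN1r powRN.
have -> : 2 `^ s = 2 * 2 `^ (s - 1) :> R.
  by rewrite mulr_powRB1// /s divr_gt0// ltr0n.
have q0 : 0 < 2 `^ (s - 1) :> R by rewrite powR_gt0.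
by field; rewrite !gt_eqF.
Qed.

End chi2_Gamma.

(** * The Pearson statistic of a normal vector *)

Section sigma_inverse.
Context {R : realType} {d : nat}.
Implicit Types (p v : 'cV[R]_d).

Definition last_coord p : R := 1 - \sum_(j < d) p j 0.

Lemma invmx_right_inverse (A B : 'M[R]_d) : A *m B = 1%:M -> invmx A = B.
Proof.
move=> AB; have [Au _] := mulmx1_unit AB.
by rewrite -[RHS](mulKmx Au) AB mulmx1.
Qed.

(** The Sherman-Morrison formula applied to [diag p - p p^T]. *)
Definition Sigma_inv p : 'M[R]_d :=
  \matrix_(i, j) ((p i 0)^-1 *+ (i == j) + (last_coord p)^-1).

Lemma SigmaE p i j : Sigma p i j = p i 0 *+ (i == j) - p i 0 * p j 0.
Proof. by rewrite /Sigma !mxE big_ord1 !mxE. Qed.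

Lemma mul_Sigma_inv p : (forall i, p i 0 != 0) -> last_coord p != 0 ->
  Sigma p *m Sigma_inv p = 1%:M.
Proof.
move=> p0 r0; apply/matrixP => i k; rewrite [LHS]mxE.
under eq_bigr => j _ do rewrite SigmaE mxE.
have E (j : 'I_d) : (p i 0 *+ (i == j) - p i 0 * p j 0) *
    ((p j 0)^-1 *+ (j == k) + (last_coord p)^-1) =
    (if j == i then (i == k)%:R + p i 0 / last_coord p else 0)
    - ((if j == k then p i 0 else 0) + p i 0 / last_coord p * p j 0).
  rewrite [j == i]eq_sym; have [->|ij] := eqVneq i j; have [->|jk] := eqVneq j k;
    rewrite ?eqxx ?mulr1n ?mulr0n; field; rewrite ?p0 ?r0//.
under eq_bigr => j _ do rewrite E.
rewrite big_split/= -!big_mkcond/= big_pred1_eq sumrN big_split/= -big_mkcond/=.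
rewrite big_pred1_eq -mulr_sumr.
rewrite (_ : \sum_j p j 0 = 1 - last_coord p); last by rewrite /last_coord opprB addrC subrK.
by rewrite mxE; field.
Qed.

Lemma invmx_Sigma p : (forall i, p i 0 != 0) -> last_coord p != 0 ->
  invmx (Sigma p) = Sigma_inv p.
Proof. by move=> p0 r0; apply: invmx_right_inverse; exact: mul_Sigma_inv. Qed.

Lemma Sigma_inv_form p v : (v^T *m Sigma_inv p *m v) 0 0 =
  \sum_i v i 0 ^+ 2 / p i 0 + (\sum_i v i 0) ^+ 2 / last_coord p.
Proof.
rewrite mxE.
under eq_bigr => j _.
  rewrite mxE.
  under eq_bigr => i _ do rewrite !mxE mulrDr.
  rewrite big_split/= -mulr_suml (bigD1 j)//= eqxx mulr1n big1 ?addr0; last first.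
    by move=> i /negbTE ->; rewrite mulr0n mulr0.
  rewrite mulrDl mulrAC -expr2; over.
rewrite big_split/=; congr (_ + _).
by rewrite -mulr_sumr mulrAC -expr2.
Qed.

End sigma_inverse.

Section pearson.
Context {R : realType} {d : nat}.
Variables (n : nat) (p : 'cV[R]_d).
Hypothesis n0 : (0 < n)%N.
Hypothesis p0 : forall i, 0 < p i 0.
Hypothesis r0 : 0 < last_coord p.
Implicit Types t : d.-tuple R.

Let nR0 : (0 : R) < n%:R. Proof. by rewrite ltr0n. Qed.
Let p_neq0 i : p i 0 != 0. Proof. by rewrite gt_eqF. Qed.
Let r_neq0 : last_coord p != 0. Proof. by rewrite gt_eqF. Qed.

Lemma pearson_tupleE t : pearson_tuple n p t =
  \sum_i (tnth t i - n%:R * p i 0) ^+ 2 / (n%:R * p i 0)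
  + (\sum_i (tnth t i - n%:R * p i 0)) ^+ 2 / (n%:R * last_coord p).
Proof.
rewrite /pearson_tuple /pearson invmx_Sigma// Sigma_inv_form.
have s2 : (Num.sqrt n%:R)^-1 ^+ 2 = n%:R^-1 :> R by rewrite exprVn sqr_sqrtr ?ltW.
congr (_ + _).
  by apply: eq_bigr => i _; rewrite !mxE exprMn s2 invfM; ring.
under eq_bigr => i _ do rewrite !mxE.
by rewrite -mulr_sumr exprMn s2 invfM; ring.
Qed.

Definition pearson_weights : seq (R * R) :=
  [seq (n%:R * p i 0, n%:R * p i 0) | i <- enum 'I_d].

Lemma size_pearson_weights : size pearson_weights = d.
Proof. by rewrite size_map size_enum_ord. Qed.

Lemma pearson_weights_gt0 : all (fun c => 0 < c.2) pearson_weights.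
Proof. by apply/allP => _ /mapP[i _ ->] /=; rewrite mulr_gt0. Qed.

Lemma pearson_residual_form t :
  pearson_tuple n p t = residual_form pearson_weights t 0 (n%:R * last_coord p).
Proof.
rewrite residual_formE ?size_pearson_weights ?size_tuple// pearson_tupleE add0r.
have E (i : 'I_d) : pearson_weights`_i = (n%:R * p i 0, n%:R * p i 0).
  by rewrite (nth_map i) ?size_enum_ord// nth_ord_enum.
congr (_ + _ ^+ 2 / _); apply: eq_bigr => i _; by rewrite E (tnth_nth 0).
Qed.

(** This is the determinant of [n Sigma_p], in factored form. *)
Definition pearson_det : R :=
  (\prod_i (n%:R * p i 0)) * (n%:R * last_coord p) / n%:R.

Lemma weight_volume_pearson : weight_volume pearson_weights (n%:R * last_coord p) = pearson_det.
Proof.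
rewrite /weight_volume /weight_total /pearson_weights !big_map/= -mulr_sumr -mulrDr.
by rewrite subrK mulr1.
Qed.

Lemma pearson_det_gt0 : 0 < pearson_det.
Proof. by rewrite -weight_volume_pearson weight_volume_gt0 ?mulr_gt0 ?pearson_weights_gt0. Qed.

Lemma iter_integral_pearson (g : R -> \bar R) : measurable_fun setT g ->
  (forall s, 0 <= g s)%E ->
  (iter_integral (fun t : d.-tuple R => g (pearson_tuple n p t)) =
   (Num.sqrt pearson_det)%:E * radial d g)%E.
Proof.
move=> mg g0.
under [X in iter_integral X]eq_fun do rewrite pearson_residual_form.
rewrite iter_integral_residual_form ?size_pearson_weights ?pearson_weights_gt0 ?mulr_gt0//.
rewrite weight_volume_pearson /radial; congr (_ * iter_integral _)%E.
by apply/funext => z; rewrite expr0n/= mul0r addr0.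
Qed.

Lemma mvnormal_pdfE t :
  mvnormal_pdf (n%:R *: p) (n%:R *: Sigma p) (col_of_tuple t) =
  expR (- (pearson_tuple n p t / 2))
    / Num.sqrt ((2 * pi) ^+ d * \det (n%:R *: Sigma p)).
Proof.
rewrite /mvnormal_pdf; congr (expR (- _) / _); rewrite mulrC; congr (_ / _).
have -> : invmx (n%:R *: Sigma p) = n%:R^-1 *: Sigma_inv p.
  apply: invmx_right_inverse; rewrite -scalemxAl -scalemxAr scalerA mulfV ?gt_eqF//.
  by rewrite scale1r mul_Sigma_inv.
rewrite -scalemxAr -scalemxAl mxE Sigma_inv_form pearson_tupleE.
rewrite mulrDr mulr_sumr; congr (_ + _).
  by apply: eq_bigr => i _; rewrite !mxE invfM; ring.
by under eq_bigr => i _ do rewrite !mxE; rewrite invfM; ring.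
Qed.

(** The constant in front of [exp (- Q / 2)], [Q] the Pearson form, in the
    normal density. *)
Definition normal_cst : R := (Num.sqrt pearson_det * gauss_mass d)^-1.

Lemma normal_cst_gt0 : 0 < normal_cst.
Proof. by rewrite invr_gt0 mulr_gt0 ?gauss_mass_gt0// sqrtr_gt0 pearson_det_gt0. Qed.

Lemma iter_integral_pearson_ray l :
  iter_integral (fun t : d.-tuple R =>
    (\1_(pearson_tuple n p @^-1` `]-oo, l]%classic) t
      * (normal_cst * expR (- (pearson_tuple n p t / 2))))%:E)
  = (chi2_cdf d l)%:E.
Proof.
transitivity (iter_integral (fun t : d.-tuple R => (normal_cst%:E *
   ((\1_(`]-oo, l]%classic : set R) (pearson_tuple n p t)
     * expR (- (pearson_tuple n p t / 2)))%:E))%E)).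
  congr iter_integral; apply/funext => t.
  by rewrite -EFinM mulrCA; congr (_ * _)%:E; rewrite !indicE.
rewrite iter_integralZl; last 3 first.
- apply: (measurableT_comp (f := fun s : R =>
    ((\1_(`]-oo, l]%classic : set R)) s * expR (- (s / 2)))%:E)).
    exact: measurable_indic_expRN.
  exact: measurable_pearson_tuple.
- by move=> t; rewrite lee_fin mulr_ge0// expR_ge0.
- by rewrite lee_fin ltW// normal_cst_gt0.
rewrite (iter_integral_pearson (g := fun s =>
  ((\1_(`]-oo, l]%classic : set R)) s * expR (- (s / 2)))%:E)); last 2 first.
- exact: measurable_indic_expRN.
- by move=> s; rewrite lee_fin mulr_ge0// expR_ge0.
rewrite -[radial _ _]fineK ?radial_indic_expR_fin// -!EFinM /chi2_cdf.
congr EFin; rewrite /normal_cst.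
have s0 : 0 < Num.sqrt pearson_det by rewrite sqrtr_gt0 pearson_det_gt0.
have g0 := @gauss_mass_gt0 R d.
by field; rewrite !gt_eqF.
Qed.

Lemma iter_integral_pearson_quarter :
  iter_integral (fun t : d.-tuple R =>
    (normal_cst * expR (- (pearson_tuple n p t / 4)))%:E) = (Num.sqrt 2 ^+ d)%:E.
Proof.
under [X in iter_integral X]eq_fun do rewrite EFinM.
have m4 := @measurable_expRN R 4.
rewrite iter_integralZl ?lee_fin ?(ltW normal_cst_gt0)//; last first.
  apply: (measurableT_comp m4); exact: measurable_pearson_tuple.
rewrite (iter_integral_pearson (g := fun s => (expR (- (s / 4)))%:E))// radial_expR_quarter.
rewrite -!EFinM; congr EFin; rewrite /normal_cst.
have s0 : 0 < Num.sqrt pearson_det by rewrite sqrtr_gt0 pearson_det_gt0.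
have g0 := @gauss_mass_gt0 R d.
by field; rewrite !gt_eqF.
Qed.

Context {disp : measure_display} {Omega : measurableType disp}.
Variables (P : probability Omega R) (Y : {RV P >-> d.-tuple R}).
Hypothesis normalY : is_mvnormal (n%:R *: p) (n%:R *: Sigma p) Y.

(** Both [mvnormal_pdf] and the integrand are multiples of [exp (- Q / 2)] with
    total mass 1, so the multiples agree. This identifies the determinant
    of [n Sigma_p]. *)
Lemma mvnormal_distribution (B : set (d.-tuple R)) : measurable B ->
  distribution P Y B = iter_integral (fun t : d.-tuple R =>
    (\1_B t * (normal_cst * expR (- (pearson_tuple n p t / 2))))%:E).
Proof.
move=> mB; rewrite normalY//; congr iter_integral; apply/funext => t.
rewrite mvnormal_pdfE; congr (_ * _)%:E; rewrite [LHS]mulrC; congr (_ * _).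
have := normalY measurableT; rewrite probability_setT.
set c := (Num.sqrt _)^-1.
under [X in iter_integral X]eq_fun => z
  do rewrite indicT /cst mul1r mvnormal_pdfE -/c mulrC EFinM.
rewrite iter_integralZl ?lee_fin ?invr_ge0 ?sqrtr_ge0//.
- rewrite (iter_integral_pearson (g := fun s => (expR (- (s / 2)))%:E))//; last first.
    exact: measurable_expRN.
  rewrite radial_expR -!EFinM => -[] /esym/(congr1 ( *%R^~ normal_cst)).
  rewrite mul1r -mulrA divff ?mulr1// mulf_neq0 ?gt_eqF ?gauss_mass_gt0//.
  by rewrite sqrtr_gt0 pearson_det_gt0.
- apply/measurable_EFinP; apply: measurableT_comp => //.
  apply: measurableT_comp => //; apply: measurable_funM => //.
Qed.

Lemma cdf_pearson_normal l :
  cdf (pearson_RV n p Y) l = (chi2_cdf d l)%:E.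
Proof.
rewrite -iter_integral_pearson_ray -mvnormal_distribution//.
rewrite -[X in measurable X]setTI; exact: measurable_pearson_tuple.
Qed.

End pearson.

(** * Logarithm estimates and Stirling's formula *)

Section log_bounds.
Context {R : realType}.
Implicit Types x u : R.

Lemma le_of_derive_ge0 (f df : R -> R) x : 0 <= x ->
  (forall y : R, 0 <= y -> is_derive y 1 f (df y)) ->
  (forall y, 0 <= y -> 0 <= df y) ->
  f 0 <= f x.
Proof.
move=> x0 dF df0; rewrite -subr_ge0.
have [|||c] := @MVT_segment _ f df 0 x => //.
- by move=> y; rewrite in_itv/= => /andP[y0 _]; apply: dF; exact: ltW.
- apply: derivable_within_continuous => y; rewrite in_itv/= => /andP[y0 _].
  by have [] := dF _ y0.
- by rewrite in_itv/= => /andP[c0 _] ->; rewrite mulr_ge0 ?subr0// df0.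
Qed.

Lemma is_derive_addl (a x : R) : is_derive x 1 (fun y : R => a + y) 1.
Proof.
rewrite (_ : (fun y => a + y) = shift a); first exact: is_derive_shift.
by apply/funext => y; rewrite /= addrC.
Qed.

Lemma is_derive_ln1D x : 0 <= x -> is_derive x 1 (fun y : R => ln (1 + y)) (1 + x)^-1.
Proof.
move=> x0.
have h : is_derive (1 + x) 1 (@ln R) (1 + x)^-1 by apply: is_derive1_ln; lra.
by have := @is_derive1_comp _ (@ln R) (fun y => 1 + y) x _ _ h (is_derive_addl 1 x); rewrite mulr1.
Qed.

Lemma is_derive_invD (a x : R) : 0 < a + x ->
  is_derive x 1 (fun y : R => (a + y)^-1) (- (a + x) ^- 2).
Proof.
move=> ax; have ax0 : a + x != 0 by rewrite gt_eqF.
have := @is_deriveV _ (fun y => a + y) x 1 _ ax0 (is_derive_addl a x).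
by rewrite /GRing.scale/= mulr1.
Qed.

(** This and the next bound are the midpoint and the trapezoidal rule for the
    integral of [1 / t] from 1 to [1 + x]; they err on opposite sides as [1 / t]
    is convex. *)
Lemma ln1D_midpoint x : 0 <= x -> 2 * x / (2 + x) <= ln (1 + x).
Proof.
move=> x0; rewrite -subr_ge0.
have -> : ln (1 + x) - 2 * x / (2 + x) = ln (1 + x) - (2 - 4 * (2 + x)^-1).
  by field; rewrite gt_eqF; lra.
pose f y : R := ln (1 + y) - (2 - 4 * (2 + y)^-1).
pose df y : R := (1 + y)^-1 - 4 * (2 + y) ^- 2.
have <- : f 0 = 0 by rewrite /f addr0 ln1 addr0; field.
apply: (@le_of_derive_ge0 f df x x0) => y y0.
  have h1 := is_derive_ln1D y0.
  have h2 : is_derive y 1 (fun z : R => (2 + z)^-1) (- (2 + y) ^- 2).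
    by apply: is_derive_invD; lra.
  have h := is_deriveB h1 (is_deriveB (is_derive_cst (2 : R) y 1) (is_deriveZ 4 h2)).
  by apply: (is_derive_eq h); rewrite /df /GRing.scale/=; ring.
rewrite /df (_ : _ - _ = y ^+ 2 / ((1 + y) * (2 + y) ^+ 2)).
  by rewrite divr_ge0 ?sqr_ge0// mulr_ge0 ?sqr_ge0//; lra.
by field; rewrite !gt_eqF//; lra.
Qed.

Lemma ln1D_trapezoid x : 0 <= x -> ln (1 + x) <= x * (2 + x) / (2 * (1 + x)).
Proof.
move=> x0; rewrite -subr_ge0.
pose f y : R := 2^-1 * ((1 + y) - (1 + y)^-1) - ln (1 + y).
pose df y : R := 2^-1 * (1 + (1 + y) ^- 2) - (1 + y)^-1.
have -> : x * (2 + x) / (2 * (1 + x)) - ln (1 + x) = f x.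
  by rewrite /f; field; rewrite gt_eqF//; lra.
have <- : f 0 = 0 by rewrite /f addr0 ln1; field.
apply: (@le_of_derive_ge0 f df x x0) => y y0.
  have h1 := is_derive_ln1D y0.
  have h2 : is_derive y 1 (fun z : R => (1 + z)^-1) (- (1 + y) ^- 2).
    by apply: is_derive_invD; lra.
  have h := is_deriveB (is_deriveZ 2^-1 (is_deriveB (is_derive_addl 1 y) h2)) h1.
  by apply: (is_derive_eq h); rewrite /df /GRing.scale/=; ring.
rewrite /df (_ : _ - _ = 2^-1 * (1 - (1 + y)^-1) ^+ 2); last first.
  by field; rewrite gt_eqF//; lra.
by rewrite mulr_ge0 ?sqr_ge0.
Qed.

(** For [u >= 0] the trapezoidal rule gives the bound without the cubic term.
    For [u < 0] the midpoint rule, applied to [ln (1 + u)^-1], costs at most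
    half of the cubic term. *)
Lemma mul_ln1D_le u : -1 < u -> (1 + u) * ln (1 + u) <= u + u ^+ 2 / 2 + `|u| ^+ 3.
Proof.
move=> u1; have w0 : 0 < 1 + u by lra.
have [u0|u0] := leP 0 u.
  have := ln1D_trapezoid u0; rewrite -(ler_pM2l w0) => /le_trans; apply.
  rewrite (_ : (1 + u) * (u * (2 + u) / (2 * (1 + u))) = u + u ^+ 2 / 2); last first.
    by field; rewrite gt_eqF.
  by rewrite lerDl exprn_ge0.
have y0 : 0 <= - u / (1 + u) by rewrite divr_ge0 ?ltW//; lra.
have := ln1D_midpoint y0.
have -> : 1 + - u / (1 + u) = (1 + u)^-1 by field; rewrite gt_eqF.
rewrite lnV ?posrE// lerNr => /(ler_wpM2l (ltW w0)) /le_trans; apply.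
have -> : 2 * (- u / (1 + u)) / (2 + - u / (1 + u)) = - (2 * u / (2 + u)).
  by field; rewrite !gt_eqF//; lra.
have -> : (1 + u) * - - (2 * u / (2 + u)) =
    u + u ^+ 2 / 2 + (- u) ^+ 3 * (2 * (2 + u))^-1.
  by field; rewrite !gt_eqF//; lra.
rewrite ltr0_norm// lerD2l ler_piMr ?exprn_ge0 ?oppr_ge0 ?ltW//.
by rewrite invf_lt1; lra.
Qed.

End log_bounds.

Section stirling.
Context {R : realType}.

(** The left side is the Beta integral of [x^n (1 - x)^n], and
    [x (1 - x) <= exp (- 4 (x - 1/2)^2) / 4]. *)
Lemma wallis_bound (n : nat) : (0 < n)%N ->
  (n`! * n`!)%:R / ((n + n).+1`!)%:R <= 4 ^- n * (Num.sqrt pi / (2 * Num.sqrt n%:R)) :> R.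
Proof.
move=> n0; rewrite -beta_fun_fact -lee_fin EFin_beta_fun.
have nR : (0 : R) < n%:R by rewrite ltr0n.
have sn0 : 0 < Num.sqrt n%:R :> R by rewrite sqrtr_gt0.
have mg : measurable_fun setT (fun x : R =>
    (gauss_fun (2 * Num.sqrt n%:R * x - Num.sqrt n%:R))%:E).
  apply/measurable_EFinP; apply: measurableT_comp; first exact: measurable_gauss_fun.
  by apply: measurable_funB => //; exact: measurable_funM.
have -> : (4 ^- n * (Num.sqrt pi / (2 * Num.sqrt n%:R)))%:E =
    (\int[lebesgue_measure]_x ((4 ^- n)%:E *
      (gauss_fun (2 * Num.sqrt n%:R * x - Num.sqrt n%:R))%:E) :> \bar R)%E.
  rewrite ge0_integralZl ?lee_fin ?invr_ge0 ?exprn_ge0//; last first.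
    by move=> x _; rewrite lee_fin gauss_fun_ge0.
  have := @integral_affine R (2 * Num.sqrt n%:R) (- Num.sqrt n%:R)
    (fun x => (gauss_fun x)%:E).
  rewrite integralT_gauss; set I := integral _ _ _ => H.
  have {}H : (Num.sqrt pi)%:E = ((2 * Num.sqrt n%:R)%:E * I)%E.
    apply: H; first by rewrite mulr_gt0.
      by apply/measurable_EFinP; exact: measurable_gauss_fun.
    by move=> x; rewrite lee_fin gauss_fun_ge0.
  rewrite EFinM [in LHS]mulrC [in LHS]EFinM H [in LHS](muleA (2 * _)^-1%:E).
  by rewrite -(EFinM (2 * _)^-1) mulVf ?gt_eqF ?mulr_gt0// mul1e.
apply: ge0_le_integral => //.
- move=> x _; rewrite lee_fin patchE; case: ifPn => // /[!inE] x01.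
  by apply: XMonemX_ge0.
- by apply/measurable_EFinP; apply/(measurable_restrictT _ _).1 => //; exact: measurable_XMonemX.
- exact: measurable_funeM.
- move=> x _; rewrite -EFinM lee_fin patchE; case: ifPn => [|_]; last first.
    by rewrite mulr_ge0 ?gauss_fun_ge0 ?invr_ge0 ?exprn_ge0.
  rewrite inE/= in_itv/= => /andP[x0 x1].
  rewrite /XMonemX /unstable.onem/= -exprMn -exprVn.
  have -> : gauss_fun (2 * Num.sqrt n%:R * x - Num.sqrt n%:R) =
      expR (- (4 * (x - 2^-1) ^+ 2)) ^+ n :> R.
    rewrite /gauss_fun -expRM_natl; congr expR.
    by rewrite -[in n%:R * _](sqr_sqrtr (ltW nR)); field.
  rewrite -exprMn; rewrite lerXn2r ?nnegrE ?mulr_ge0 ?expR_ge0//; try lra.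
  have := expR_ge1Dx (- (4 * (x - 2^-1) ^+ 2)); nra.
Qed.

End stirling.

Section stirling_formula.
Context {R : realType}.
Implicit Types n k : nat.

(** The logarithm of [n! e^n / n^(n + 1/2)], which decreases to
    [ln (sqrt (2 pi))]. *)
Definition stirling_log n : R := ln n`!%:R + n%:R - (n%:R + 2^-1) * ln n%:R.

(** The decrement is [(n + 1/2) ln (1 + 1/n) - 1], the relative error of the
    midpoint rule; the trapezoidal rule bounds it by a telescoping term. *)
Lemma stirling_log_step n : (0 < n)%N ->
  0 <= stirling_log n - stirling_log n.+1 <= 4^-1 * (n%:R^-1 - n.+1%:R^-1).
Proof.
move=> n0; have nR : (0 : R) < n%:R by rewrite ltr0n.
have f0 : (0 : R) < n`!%:R by rewrite ltr0n fact_gt0.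
pose x : R := n%:R^-1; have x0 : 0 < x by rewrite invr_gt0.
have S1 : n.+1%:R = n%:R + 1 :> R by rewrite -natr1.
have -> : stirling_log n - stirling_log n.+1 = (n%:R + 2^-1) * ln (1 + x) - 1.
  have -> : 1 + x = n.+1%:R / n%:R by rewrite S1 /x; field; rewrite gt_eqF.
  rewrite ln_div ?posrE// /stirling_log factS natrM lnM ?posrE// S1.
  by ring.
have nE : n%:R = x^-1 by rewrite invrK.
clearbody x; rewrite S1 !nE invrK.
have E : x^-1 + 2^-1 = (2 + x) / (2 * x) by field; rewrite gt_eqF.
have y0 : 0 < (2 + x) / (2 * x) by rewrite divr_gt0//; lra.
rewrite E; apply/andP; split.
  have := ln1D_midpoint (ltW x0); rewrite -(ler_pM2l y0).
  have -> : (2 + x) / (2 * x) * (2 * x / (2 + x)) = 1.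
    by field; rewrite !gt_eqF//; lra.
  lra.
have := ln1D_trapezoid (ltW x0); rewrite -(ler_pM2l y0).
have -> : (2 + x) / (2 * x) * (x * (2 + x) / (2 * (1 + x))) =
    1 + 4^-1 * (x - (x^-1 + 1)^-1).
  by field; rewrite !gt_eqF//; nra.
lra.
Qed.

Lemma stirling_log_mono k n : (0 < k)%N -> (k <= n)%N ->
  stirling_log n <= stirling_log k /\
  stirling_log k - 4^-1 * k%:R^-1 <= stirling_log n - 4^-1 * n%:R^-1.
Proof.
move=> k0 /subnK <-; elim: (n - k)%N => [|m [IH1 IH2]]; first by rewrite add0n.
rewrite addSn.
have /andP[] := @stirling_log_step (m + k) (leq_trans k0 (leq_addl _ _)).
move=> h1; move: IH2.
move: ((m + k)%:R^-1) ((m + k).+1%:R^-1) => a b h2 h3; split; lra.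
Qed.

Definition stirling_cst : R := inf [set stirling_log n.+1 | n in [set: nat]].

Let stirling_lb k : (0 < k)%N ->
  lbound [set stirling_log n.+1 | n in [set: nat]] (stirling_log k - 4^-1 * k%:R^-1).
Proof.
move=> k0 _ [n _ <-].
have k1 : 0 < (k%:R)^-1 :> R by rewrite invr_gt0 ltr0n.
have [kn|nk] := leqP k n.+1.
  have [_] := stirling_log_mono k0 kn.
  have : 0 <= (n.+1%:R)^-1 :> R by rewrite invr_ge0.
  by move: (n.+1%:R^-1) (stirling_log n.+1) => a b; lra.
have [+ _] := stirling_log_mono (ltn0Sn n) (ltnW nk).
by move: (stirling_log n.+1) => b; lra.
Qed.

Lemma stirling_cst_le_log n : (0 < n)%N -> stirling_cst <= stirling_log n.
Proof.
move=> n0; apply: ge_inf; last by exists n.-1 => //; rewrite prednK.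
by exists (stirling_log 1 - 4^-1 * 1%:R^-1); exact: stirling_lb.
Qed.

Lemma stirling_log_le n : (0 < n)%N -> stirling_log n <= stirling_cst + 4^-1 * n%:R^-1.
Proof.
move=> n0; rewrite -lerBlDr; apply: lb_le_inf; last exact: stirling_lb.
by exists (stirling_log 1); exists 0.
Qed.

Lemma wallis_stirling n : (0 < n)%N ->
  2 * stirling_log n - stirling_log (n + n) <= 2^-1 * ln (2 * pi) + 2^-1 * n%:R^-1.
Proof.
move=> n0; have nR : (0 : R) < n%:R by rewrite ltr0n.
have pi0 : 0 < pi :> R := pi_gt0 R.
have f0 k : (0 : R) < k`!%:R by rewrite ltr0n fact_gt0.
have := @wallis_bound R _ n0.
have l0 : 0 < (n`! * n`!)%:R / ((n + n).+1`!)%:R :> R.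
  by rewrite divr_gt0 ?f0// natrM mulr_gt0.
rewrite -ler_ln ?posrE//; last first.
  by rewrite mulr_gt0 ?invr_gt0 ?exprn_gt0// divr_gt0 ?mulr_gt0 ?sqrtr_gt0.
have -> : ln ((n`! * n`!)%:R / ((n + n).+1`!)%:R) =
    2 * ln n`!%:R - ln (n + n)`!%:R - ln (n + n).+1%:R :> R.
  have fM : 0 < (n`! * n`!)%:R :> R by rewrite natrM mulr_gt0.
  rewrite ln_div ?posrE ?f0// factS !natrM !lnM ?posrE ?f0//.
  by ring.
have ln4 : ln 4 = 2 * ln 2 :> R.
  have -> : 4 = 2 * 2 :> R by lra.
  by rewrite lnM ?posrE//; lra.
have lnsqrt x : 0 < x -> ln (Num.sqrt x) = 2^-1 * ln x :> R.
  by move=> x0; rewrite -powR12_sqrt ?ltW// ln_powR.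
have -> : ln (4 ^- n * (Num.sqrt pi / (2 * Num.sqrt n%:R))) =
    - (2 * n%:R * ln 2) + (2^-1 * ln pi - (ln 2 + 2^-1 * ln n%:R)) :> R.
  rewrite lnM ?posrE ?invr_gt0 ?exprn_gt0// ?divr_gt0 ?mulr_gt0 ?sqrtr_gt0//.
  rewrite ln_div ?posrE ?mulr_gt0 ?sqrtr_gt0// lnM ?posrE ?sqrtr_gt0//.
  rewrite !lnsqrt// lnV ?posrE ?exprn_gt0// lnXn// ln4 -mulr_natl.
  by ring.
have -> : ln (2 * pi) = ln 2 + ln pi :> R by rewrite lnM ?posrE.
have -> : stirling_log (n + n) = ln (n + n)`!%:R + 2 * n%:R
    - (2 * n%:R + 2^-1) * (ln 2 + ln n%:R).
  by rewrite /stirling_log natrD -mulr2n -(mulr_natl n%:R 2) lnM ?posrE.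
have -> : ln (n + n).+1%:R = ln 2 + ln n%:R + ln (1 + 2^-1 * n%:R^-1) :> R.
  rewrite -!lnM ?posrE ?mulr_gt0 ?addr_gt0 ?mulr_gt0 ?invr_gt0//.
  by congr ln; rewrite -natr1 natrD; field; rewrite gt_eqF.
have x0 : 0 <= 2^-1 * n%:R^-1 :> R by rewrite mulr_ge0// invr_ge0 ltW.
have lx : ln (1 + 2^-1 * n%:R^-1) <= 2^-1 * n%:R^-1 :> R.
  by rewrite -[leRHS]expRK ler_ln ?posrE ?expR_gt0 ?expR_ge1Dx//; lra.
rewrite /stirling_log; nra.
Qed.

(** In [2 * stirling_log n - stirling_log (n + n)] the factorials form a central binomial coefficient,
    bounded in [wallis_bound]. A multinomial coefficient has [d] more factorials
    below the fraction bar than above it, so an upper bound on the constant is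
    what yields a lower bound on multinomial masses. *)
Lemma stirling_cst_le : stirling_cst <= 2^-1 * ln (2 * pi).
Proof.
apply/ler_addgt0Pr => e e0.
pose n := (Num.truncn e^-1).+1.
have ne : n%:R^-1 < e.
  by rewrite invf_plt ?posrE ?ltr0n// truncnS_gt.
have h1 := stirling_cst_le_log (ltn0Sn (Num.truncn e^-1)).
have nn0 : (0 < n + n)%N by [].
have h2 := stirling_log_le nn0.
have h3 := @wallis_stirling n (ltn0Sn _).
have : (n + n)%:R^-1 = 2^-1 * n%:R^-1 :> R.
  by rewrite natrD -mulr2n -(mulr_natl n%:R 2) invfM.
rewrite -/n in h1; move=> E; rewrite E in h2; lra.
Qed.

Lemma fact_ge n : (0 < n)%N ->
  expR (stirling_cst + (n%:R + 2^-1) * ln n%:R - n%:R) <= n`!%:R.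
Proof.
move=> n0; have f0 : (0 : R) < n`!%:R by rewrite ltr0n fact_gt0.
rewrite -[leRHS]lnK ?posrE// ler_expR.
by have := stirling_cst_le_log n0; rewrite /stirling_log; lra.
Qed.

Lemma fact_le n : (0 < n)%N ->
  n`!%:R <= expR (stirling_cst + 4^-1 * n%:R^-1 + (n%:R + 2^-1) * ln n%:R - n%:R).
Proof.
move=> n0; have f0 : (0 : R) < n`!%:R by rewrite ltr0n fact_gt0.
rewrite -[leLHS]lnK ?posrE// ler_expR.
by have := stirling_log_le n0; rewrite /stirling_log; lra.
Qed.

End stirling_formula.

(** * A local lower bound for multinomial masses *)

Section multinomial_lower_bound.
Context {R : realType}.

(** The loss in a category with mean [m] and deviation [x]: the cubic term in
    the expansion of [k ln (k / m)], then the replacement of [ln k] by [ln m] in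
    Stirling's formula, then the remainder of that formula. *)
Definition local_error (m x : R) : R :=
  `|x| ^+ 3 / m ^+ 2 + `|x| / (2 * m) + (2 * m)^-1.

(** Stirling's formula for [k!] and the expansion of [k ln (k / m)] to second
    order at [k = m]. *)
Lemma expR_le_power_fact (n k : nat) (q m : R) : (0 < n)%N -> (0 < k)%N -> 0 < q ->
  m = n%:R * q -> m / 2 <= k%:R ->
  expR (m - k%:R * ln n%:R - 2^-1 * ln m - (k%:R - m) ^+ 2 / (2 * m)
    - local_error m (k%:R - m) - stirling_cst) <= q ^+ k / k`!%:R.
Proof.
move=> n0 k0 q0 mE mk.
have nR : (0 : R) < n%:R by rewrite ltr0n.
have kR : (0 : R) < k%:R by rewrite ltr0n.
have m0 : 0 < m by rewrite mE mulr_gt0.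
have fk := @fact_le R _ k0.
have f0 : (0 : R) < k`!%:R by rewrite ltr0n fact_gt0.
apply: (@le_trans _ _ (expR (k%:R * ln q -
    (stirling_cst + 4^-1 * k%:R^-1 + (k%:R + 2^-1) * ln k%:R - k%:R)))); last first.
  have -> : q ^+ k = expR (k%:R * ln q) by rewrite expRM_natl lnK.
  by rewrite expRB ler_pM2l ?expR_gt0// lef_pV2 ?posrE ?expR_gt0.
rewrite ler_expR.
(* The relative deviation of the count: k = m (1 + u). *)
pose u := k%:R / m - 1.
have mu : k%:R - m = m * u by rewrite /u; field; rewrite gt_eqF.
have w0 : 0 < 1 + u by rewrite /u addrC subrK divr_gt0.
have lk : ln k%:R = ln m + ln (1 + u).
  by rewrite -lnM ?posrE// /u; congr ln; field; rewrite gt_eqF.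
have lq : ln q = ln m - ln n%:R by rewrite -ln_div ?posrE// mE mulrAC mulfV ?gt_eqF// mul1r.
have h1 := @mul_ln1D_le R u (ltac:(lra)).
have h2 : ln (1 + u) <= `|u|.
  apply: (@le_trans _ _ u); last exact: ler_norm.
  by rewrite -[leRHS]expRK ler_ln ?posrE ?expR_gt0// expR_ge1Dx.
have h3 : 4^-1 * k%:R^-1 <= (2 * m)^-1.
  have -> : 4^-1 * k%:R^-1 = (4 * k%:R)^-1 :> R by rewrite invfM.
  by rewrite lef_pV2 ?posrE ?mulr_gt0//; lra.
have kE : k%:R = m * (1 + u) by rewrite mulrDr mulr1 -mu addrC subrK.
rewrite /local_error lk lq mu normrM (gtr0_norm m0).
have -> : (m * u) ^+ 2 / (2 * m) = m * (u ^+ 2 / 2) by field; rewrite gt_eqF.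
have -> : (m * `|u|) ^+ 3 / m ^+ 2 = m * `|u| ^+ 3 by field; rewrite gt_eqF.
have -> : m * `|u| / (2 * m) = 2^-1 * `|u| by field; rewrite gt_eqF.
have h4 := ler_wpM2l (ltW m0) h1.
have h5 : k%:R * ln (1 + u) = m * ((1 + u) * ln (1 + u)) by rewrite kE mulrA.
have h6 : m * (u + u ^+ 2 / 2 + `|u| ^+ 3) = k%:R - m + m * (u ^+ 2 / 2) + m * `|u| ^+ 3.
  by rewrite mu; ring.
move: h3 h4 h5 h6.
move: (4^-1 * k%:R^-1) ((2 * m)^-1) (m * (u ^+ 2 / 2)) (m * `|u| ^+ 3) => a b c e.
move=> h3 h4 h5 h6; rewrite h6 -h5 in h4.
nra.
Qed.

Context {d : nat}.
Variables (n : nat) (p : 'cV[R]_d).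
Hypothesis n0 : (0 < n)%N.
Hypothesis p0 : forall i, 0 < full_coord p i.

Lemma full_coord_lift j : full_coord p (lift ord_max j) = p j 0.
Proof. by rewrite /full_coord liftK. Qed.

Lemma full_coord_max : full_coord p ord_max = last_coord p.
Proof. by rewrite /full_coord unlift_none. Qed.

Lemma sum_ord_lift (V : nmodType) (F : 'I_d.+1 -> V) :
  \sum_i F i = \sum_(j < d) F (lift ord_max j) + F ord_max.
Proof.
rewrite big_ord_recr/=; congr (_ + _); apply: eq_bigr => j _; congr F.
by apply: val_inj; rewrite /= /bump leqNgt ltn_ord.
Qed.

Lemma prod_ord_lift (F : 'I_d.+1 -> R) :
  \prod_i F i = \prod_(j < d) F (lift ord_max j) * F ord_max.
Proof.
rewrite big_ord_recr/=; congr (_ * _); apply: eq_bigr => j _; congr F.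
by apply: val_inj; rewrite /= /bump leqNgt ltn_ord.
Qed.

Lemma sum_full_coord : \sum_i full_coord p i = 1.
Proof.
rewrite sum_ord_lift full_coord_max.
by under eq_bigr do rewrite full_coord_lift; rewrite addrC subrK.
Qed.

Lemma coord_gt0 j : 0 < p j 0.
Proof. by rewrite -full_coord_lift. Qed.

Lemma last_coord_gt0 : 0 < last_coord p.
Proof. by rewrite -full_coord_max. Qed.

Definition category_mean i : R := n%:R * full_coord p i.

Lemma category_mean_gt0 i : 0 < category_mean i.
Proof. by rewrite mulr_gt0 ?ltr0n. Qed.

Lemma sum_category_mean : \sum_i category_mean i = n%:R.
Proof. by rewrite -mulr_sumr sum_full_coord mulr1. Qed.

Lemma normal_cstE : normal_cst n p =
  expR (2^-1 * ln n%:R - 2^-1 * (\sum_i ln (category_mean i)) - d%:R * (2^-1 * ln (2 * pi))).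
Proof.
have nR : (0 : R) < n%:R by rewrite ltr0n.
have pp : 0 < 2 * pi :> R by rewrite mulr_gt0// pi_gt0.
have lnsqrt x : 0 < x -> Num.sqrt x = expR (2^-1 * ln x) :> R.
  by move=> x0; rewrite mulrC expRM lnK ?posrE// powR12_sqrt ?ltW.
rewrite /normal_cst /gauss_mass.
have -> : pearson_det n p = (\prod_i category_mean i) / n%:R.
  rewrite /pearson_det prod_ord_lift /category_mean full_coord_max.
  by under [in RHS]eq_bigr do rewrite full_coord_lift.
have -> : \prod_i category_mean i = expR (\sum_i ln (category_mean i)).
  by rewrite expR_sum; apply: eq_bigr => i _; rewrite lnK ?posrE ?category_mean_gt0.
rewrite !lnsqrt ?divr_gt0 ?expR_gt0// -expRM_natl -expRD -expRN; congr expR.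
by rewrite ln_div ?posrE ?expR_gt0// expRK; ring.
Qed.

Variable k : d.-tuple nat.
Hypothesis kn : (\sum_(j < d) tnth k j <= n)%N.
Hypothesis kbulk : forall i, category_mean i / 2 <= (full_count n k i)%:R.

Lemma sum_full_count : \sum_i (full_count n k i)%:R = n%:R :> R.
Proof.
rewrite -natr_sum; congr (_%:R); rewrite big_ord_recr/=.
rewrite {2}/full_count unlift_none (eq_bigr (tnth k)) ?subnKC// => j _.
rewrite (_ : widen_ord _ _ = lift ord_max j) ?/full_count ?liftK//.
by apply: val_inj; rewrite /= /bump leqNgt ltn_ord.
Qed.

Definition count_residual i : R := (full_count n k i)%:R - category_mean i.

(** In the product of the one-category bounds the linear terms cancel, as the
    counts and the means both add up to [n]; the quadratic terms add up to [Q]. *)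
Lemma multinomial_pmf_ge :
  normal_cst n p * expR (- (2^-1 * \sum_i count_residual i ^+ 2 / category_mean i)
    - \sum_i local_error (category_mean i) (count_residual i)) <= multinomial_pmf n p k.
Proof.
rewrite /multinomial_pmf kn; pose x := count_residual; rewrite -/x.
have k0 i : (0 < full_count n k i)%N.
  rewrite -(ltr0n R); apply: lt_le_trans (kbulk i).
  by rewrite divr_gt0 ?category_mean_gt0.
have -> : n`!%:R / \prod_i ((full_count n k i)`!)%:R * \prod_i full_coord p i ^+ full_count n k i
    = n`!%:R * \prod_i (full_coord p i ^+ full_count n k i / ((full_count n k i)`!)%:R) :> R.
  by rewrite big_split/= prodfV; ring.
pose b i := category_mean i - (full_count n k i)%:R * ln n%:R - 2^-1 * ln (category_mean i)
  - x i ^+ 2 / (2 * category_mean i) - local_error (category_mean i) (x i) - stirling_cst.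
have hb : expR (\sum_i b i) <=
    \prod_i (full_coord p i ^+ full_count n k i / ((full_count n k i)`!)%:R).
  rewrite expR_sum; apply: ler_prod => i _; rewrite expR_ge0/=.
  exact: (expR_le_power_fact n0 (k0 i) (p0 i) erefl (kbulk i)).
apply: le_trans (ler_pM (expR_ge0 _) (expR_ge0 _) (fact_ge n0) hb).
rewrite normal_cstE -!expRD ler_expR.
have -> : \sum_i b i = n%:R - n%:R * ln n%:R - 2^-1 * \sum_i ln (category_mean i)
    - 2^-1 * \sum_i x i ^+ 2 / category_mean i
    - \sum_i local_error (category_mean i) (x i) - d.+1%:R * stirling_cst.
  rewrite /b !sumrB sum_category_mean -mulr_suml sum_full_count -mulr_sumr.
  have -> : \sum_(i < d.+1) stirling_cst = d.+1%:R * stirling_cst :> R.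
    by rewrite sumr_const card_ord mulr_natl.
  have -> : \sum_i x i ^+ 2 / (2 * category_mean i) =
      2^-1 * \sum_i x i ^+ 2 / category_mean i.
    by rewrite mulr_sumr; apply: eq_bigr => i _; rewrite invfM mulrCA.
  by [].
have := ler_wpM2l (ler0n R d) (@stirling_cst_le R).
rewrite -natr1; nra.
Qed.

End multinomial_lower_bound.

(** * Normal density against multinomial mass on unit cells *)

Section elementary.
Context {R : realType}.

(** A form of Minkowski's inequality with [N + 1] in place of its square root,
    which only uses that every term is bounded by the norm. *)
Lemma sum_sqr_perturb (N : nat) (v e : 'I_N.+1 -> R) (eps : R) : 0 <= eps ->
  (forall i, `|e i| <= eps) ->
  \sum_i (v i + e i) ^+ 2 <= (Num.sqrt (\sum_i v i ^+ 2) + N.+1%:R * eps) ^+ 2.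
Proof.
move=> eps0 he; set s := Num.sqrt _.
have S0 : 0 <= \sum_i v i ^+ 2 by rewrite sumr_ge0// => i _; exact: sqr_ge0.
have s0 : 0 <= s by exact: sqrtr_ge0.
have sE : s ^+ 2 = \sum_i v i ^+ 2 by rewrite sqr_sqrtr.
have vs i : `|v i| <= s.
  rewrite -sqrtr_sqr ler_wsqrtr// (bigD1 i)//= lerDl sumr_ge0// => j _.
  exact: sqr_ge0.
apply: (@le_trans _ _ (\sum_i (v i ^+ 2 + (2 * s * eps + eps ^+ 2)))).
  apply: ler_sum => i _; rewrite sqrrD -addrA lerD2l.
  have h1 : v i * e i <= s * eps.
    by rewrite (le_trans (ler_norm _))// normrM ler_pM.
  have h2 : e i ^+ 2 <= eps ^+ 2 by rewrite -real_normK ?num_real// lerXn2r ?nnegrE.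
  by rewrite mulr2n; nra.
rewrite big_split/= -sE sumr_const card_ord -[X in _ + X]mulr_natl.
have N1 : 1 <= N.+1%:R :> R by rewrite ler1n.
move: N1; move: (N.+1%:R) => a a1.
have : a * eps ^+ 2 <= (a * eps) ^+ 2.
  by rewrite exprMn ler_wpM2r ?sqr_ge0// expr2; nra.
by nra.
Qed.

(** The quadratic term of [exp (x / 4)] is [x^2 / 32]. *)
Lemma sqr_le_expR (x : R) : 0 <= x -> 1 + x ^+ 2 <= 33 * expR (x / 4).
Proof.
move=> x0; have := @expR_ge1Dxn R (x / 4) 1 (divr_ge0 x0 (ler0n _ _)).
rewrite (_ : (2`!)%:R = 2 :> R)//; nra.
Qed.

Lemma local_error_le (s t m x : R) : 0 < m -> 0 <= s -> 0 <= t ->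
  1 <= s * Num.sqrt m -> s <= 1 -> `|x| <= Num.sqrt m * t ->
  local_error m x <= 2 * s * (1 + t ^+ 4).
Proof.
move=> m0 s0 t0 sm s1 xm; rewrite /local_error.
have [r r0 mE] : exists2 r, 0 < r & m = r ^+ 2.
  by exists (Num.sqrt m); rewrite ?sqrtr_gt0// sqr_sqrtr// ltW.
move: sm xm; rewrite mE sqrtr_sqr (gtr0_norm r0) => sm xm.
have ir : r^-1 <= s by rewrite -[r^-1]mul1r ler_pdivrMr.
have ir0 : 0 < r^-1 by rewrite invr_gt0.
have h1 : `|x| ^+ 3 / r ^+ 2 ^+ 2 <= s * t ^+ 3.
  apply: (@le_trans _ _ ((r * t) ^+ 3 / r ^+ 2 ^+ 2)).
    rewrite ler_wpM2r ?invr_ge0 ?exprn_ge0 ?(ltW r0)// lerXn2r ?nnegrE//.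
    by rewrite mulr_ge0// ltW.
  have -> : (r * t) ^+ 3 / r ^+ 2 ^+ 2 = r^-1 * t ^+ 3 by field; rewrite gt_eqF.
  by rewrite ler_wpM2r// exprn_ge0.
have h2 : `|x| / (2 * r ^+ 2) <= s * t / 2.
  apply: (@le_trans _ _ (r * t / (2 * r ^+ 2))).
    by rewrite ler_wpM2r// invr_ge0 mulr_ge0// sqr_ge0.
  have -> : r * t / (2 * r ^+ 2) = r^-1 * t / 2 by field; rewrite gt_eqF.
  by rewrite !ler_wpM2r.
have h3 : (2 * r ^+ 2)^-1 <= s / 2.
  have -> : (2 * r ^+ 2)^-1 = r^-1 * r^-1 / 2 by field; rewrite gt_eqF.
  rewrite ler_wpM2r//; nra.
have h4 : t ^+ 3 + t / 2 + 2^-1 <= 2 * (1 + t ^+ 4).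
  have a1 : t ^+ 3 <= 1 + t ^+ 4.
    have -> : 1 + t ^+ 4 = t ^+ 3 + (t + (t - 1) ^+ 2 * (t ^+ 2 + t + 1)) by ring.
    by rewrite lerDl addr_ge0// mulr_ge0 ?sqr_ge0// !addr_ge0 ?sqr_ge0.
  have a2 : t <= 1 + t ^+ 4.
    have : 0 <= (t ^+ 2 - 2^-1) ^+ 2 by exact: sqr_ge0.
    have : 0 <= (t - 2^-1) ^+ 2 by exact: sqr_ge0.
    have -> : t ^+ 4 = t ^+ 2 * t ^+ 2 by ring.
    nra.
  have a3 : 0 <= t ^+ 4 by exact: exprn_ge0.
  lra.
have := ler_wpM2l s0 h4; nra.
Qed.

End elementary.

(** 33 is the constant of [sqr_le_expR]. Of the other factor, [(d + 1) 18]
    comes from the local errors of [d + 1] categories and [(d + 1) 2 d] from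
    the rounding of [y] to a lattice point. *)
Definition cell_cst (R : realType) (d : nat) : R := 33 * (d.+1%:R * (18 + 2 * d%:R)).

Lemma cell_cst_ge0 (R : realType) (d : nat) : 0 <= cell_cst R d.
Proof.
by apply: mulr_ge0 => //; apply: mulr_ge0 => //; apply: addr_ge0 => //; exact: mulr_ge0.
Qed.

Section cell_comparison.
Context {R : realType} {d : nat}.
Variables (n : nat) (p : 'cV[R]_d) (tau : R).
Hypothesis n0 : (0 < n)%N.
Hypothesis p0 : forall i, 0 < full_coord p i.
Hypothesis ptau : forall i, (full_coord p i)^-1 <= tau.

(** A bound on [1 / sqrt (n p_i)], the side of a lattice cell in coordinates
    where the normal vector is standard. All error terms are multiples of it. *)
Definition mesh : R := Num.sqrt (tau / n%:R).
Local Notation sigma := mesh.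

Hypothesis mesh_small : d.+1%:R * (d%:R * sigma) <= 1.
Hypothesis mesh_quarter : sigma <= 4^-1.

Let nR : (0 : R) < n%:R. Proof. by rewrite ltr0n. Qed.

Let mean := category_mean n p.

Let mean_gt0 i : 0 < mean i. Proof. exact: category_mean_gt0. Qed.

Let sigma0 : 0 <= sigma. Proof. exact: sqrtr_ge0. Qed.

Lemma mesh_mean i : 1 <= sigma * Num.sqrt (mean i).
Proof.
have t0 : 0 < tau by apply: lt_le_trans (ptau i); rewrite invr_gt0.
rewrite /mesh -sqrtrM; last by rewrite divr_ge0 ?(ltW t0) ?(ltW nR).
rewrite -[X in X <= _]sqrtr1 ler_wsqrtr//.
have -> : tau / n%:R * mean i = tau * full_coord p i.
  by rewrite /mean /category_mean; field; rewrite gt_eqF.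
by have := ptau i; rewrite -[(full_coord p i)^-1]mul1r ler_pdivrMr.
Qed.

(** The last entry is the deviation of the eliminated coordinate
    [n - sum_j y_j], so that [Q] is a sum of [d + 1] similar terms. *)
Definition residual (y : d.-tuple R) (i : 'I_d.+1) : R :=
  if unlift ord_max i is Some j then tnth y j - n%:R * p j 0
  else - \sum_j (tnth y j - n%:R * p j 0).

Lemma residual_lift y j : residual y (lift ord_max j) = tnth y j - n%:R * p j 0.
Proof. by rewrite /residual liftK. Qed.

Lemma residual_max y : residual y ord_max = - \sum_j (tnth y j - n%:R * p j 0).
Proof. by rewrite /residual unlift_none. Qed.

Lemma pearson_residual y :
  pearson_tuple n p y = \sum_i residual y i ^+ 2 / mean i.
Proof.
rewrite pearson_tupleE//; [|exact: coord_gt0|exact: last_coord_gt0].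
rewrite sum_ord_lift residual_max sqrrN /mean /category_mean full_coord_max.
by congr (_ + _); apply: eq_bigr => j _; rewrite residual_lift full_coord_lift.
Qed.

Lemma pearson_ge0 y : 0 <= pearson_tuple n p y.
Proof.
rewrite pearson_residual sumr_ge0// => i _.
by rewrite divr_ge0 ?sqr_ge0// (ltW (mean_gt0 _)).
Qed.

Lemma residual_le y i :
  `|residual y i| <= Num.sqrt (mean i) * Num.sqrt (pearson_tuple n p y).
Proof.
rewrite -sqrtrM ?(ltW (mean_gt0 _))// -sqrtr_sqr ler_wsqrtr// pearson_residual (bigD1 i)//= mulrDr.
rewrite mulrCA mulfV ?gt_eqF// mulr1 lerDl mulr_ge0 ?(ltW (mean_gt0 _))// sumr_ge0// => j _.
by rewrite divr_ge0 ?sqr_ge0// (ltW (mean_gt0 _)).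
Qed.

Definition floor_tuple (y : d.-tuple R) : d.-tuple nat :=
  [tuple Num.truncn (tnth y i) | i < d].

Lemma residual_count (k : d.-tuple nat) i : (\sum_(j < d) tnth k j <= n)%N ->
  residual (natr_tuple k) i = count_residual n p k i.
Proof.
move=> kn; rewrite /count_residual /category_mean /residual /full_count /full_coord.
case: unliftP => [j _|_]; first by rewrite tnth_mktuple.
under eq_bigr do rewrite tnth_mktuple.
rewrite sumrB -mulr_sumr natrB// natr_sum; ring.
Qed.

(** The bulk consists of the [y] with [2 mesh (sqrt Q + 1) <= 1]. There every
    category count, the last one included, is at least half of its mean. *)
Section bulk.
Variable y : d.-tuple R.
Local Notation Q := (pearson_tuple n p y).
Local Notation k := (floor_tuple y).
Hypothesis ybulk : 2 * sigma * (Num.sqrt Q + 1) <= 1.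

Let s := Num.sqrt Q.
Let s0 : 0 <= s. Proof. exact: sqrtr_ge0. Qed.

Let root_mean i : 2 * (s + 1) <= Num.sqrt (mean i) /\
  d.+1%:R * d%:R <= Num.sqrt (mean i).
Proof.
have := mesh_mean i; have r0 := sqrtr_ge0 (mean i).
have := ybulk; rewrite -/s; have := mesh_small.
have dd : 0 <= d.+1%:R * d%:R :> R by rewrite mulr_ge0.
rewrite mulrA; move: (Num.sqrt (mean i)) r0 dd => r r0; move: (d.+1%:R * d%:R) => D dd.
move=> h1 h2 h3; split; nra.
Qed.

Let mean_sqr i : Num.sqrt (mean i) ^+ 2 = mean i.
Proof. by rewrite sqr_sqrtr// ltW. Qed.

Lemma bulk_ge0 j : 0 <= tnth y j.
Proof.
have := residual_le y (lift ord_max j); rewrite residual_lift.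
have [+ _] := root_mean (lift ord_max j); have := mean_sqr (lift ord_max j).
rewrite {2}/mean /category_mean full_coord_lift -/s ler_norml.
move: (Num.sqrt _) => r h1 h2 /andP[+ _]; have := s0; nra.
Qed.

Let floor_err j : 0 <= tnth y j - (tnth k j)%:R <= 1.
Proof.
rewrite tnth_mktuple.
have /andP[h1 h2] := truncn_itv (bulk_ge0 j).
by move: h2; rewrite -natr1; lra.
Qed.

Let residual_err i : `|residual (natr_tuple k) i - residual y i| <= d%:R.
Proof.
rewrite /residual; case: unliftP => [j _|_].
  rewrite [tnth (natr_tuple _) _]tnth_mktuple; have /andP[h1 h2] := floor_err j.
  have d1 : 1 <= d%:R :> R by rewrite ler1n (leq_ltn_trans _ (ltn_ord j)).
  by rewrite ler_norml; lra.
have -> : - (\sum_j (tnth (natr_tuple k) j - n%:R * p j 0)) -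
    - (\sum_j (tnth y j - n%:R * p j 0)) = \sum_j (tnth y j - (tnth k j)%:R).
  rewrite opprK addrC -sumrB; apply: eq_bigr => j _.
  by rewrite [tnth (natr_tuple _) _]tnth_mktuple; ring.
rewrite ger0_norm; last by rewrite sumr_ge0// => j _; have /andP[] := floor_err j.
rewrite -[leRHS](_ : \sum_(j < d) 1 = _); last by rewrite sumr_const card_ord.
by apply: ler_sum => j _; have /andP[] := floor_err j.
Qed.

Let count_ge i : mean i / 2 <= mean i + residual (natr_tuple k) i.
Proof.
have [h3] := root_mean i; rewrite -[d.+1%:R]natr1.
have := residual_le y i; have := mean_sqr i; have := residual_err i.
have d0 : 0 <= d%:R :> R by []; have r0 := sqrtr_ge0 (mean i).
move: (d%:R : R) d0 => D d0; rewrite -/s.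
move: (Num.sqrt (mean i)) r0 h3 => r r0 h3; rewrite !ler_norml.
move=> /andP[h1 _] <- /andP[h2 _] h4.
have h5 := ler_wpM2l r0 h3; have h6 : D <= r by have := mulr_ge0 d0 d0; lra.
nra.
Qed.

Lemma floor_sum_le : (\sum_(j < d) tnth k j <= n)%N.
Proof.
have := count_ge ord_max; rewrite residual_max => h.
have : 0 <= mean ord_max - \sum_j (tnth (natr_tuple k) j - n%:R * p j 0).
  by apply: le_trans h; rewrite divr_ge0// ltW.
under eq_bigr do rewrite tnth_mktuple.
rewrite sumrB -mulr_sumr /mean /category_mean full_coord_max -natr_sum.
have -> : n%:R * last_coord p - ((\sum_(i < d) tnth k i)%:R - n%:R * \sum_i p i 0) =
    n%:R - (\sum_(i < d) tnth k i)%:R by rewrite /last_coord; ring.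
by rewrite subr_ge0 ler_nat.
Qed.

Let count_bulk i : mean i / 2 <= (full_count n k i)%:R.
Proof.
have := count_ge i; rewrite residual_count ?floor_sum_le// /count_residual.
by rewrite -/(mean i) addrC subrK.
Qed.

(** Rounding moves each of the [d + 1] standardised residuals by at most
    [d mesh]: the last residual collects the errors of all coordinates. *)
Lemma pearson_floor_le : pearson_tuple n p (natr_tuple k) <=
  (s + d.+1%:R * (d%:R * sigma)) ^+ 2.
Proof.
pose v i := residual y i / Num.sqrt (mean i).
pose e i := (residual (natr_tuple k) i - residual y i) / Num.sqrt (mean i).
have rm i : 0 < Num.sqrt (mean i) by rewrite sqrtr_gt0.
have -> : pearson_tuple n p (natr_tuple k) = \sum_i (v i + e i) ^+ 2.
  rewrite pearson_residual; apply: eq_bigr => i _.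
  by rewrite /v /e -mulrDl addrC subrK expr_div_n mean_sqr.
have -> : s = Num.sqrt (\sum_i v i ^+ 2).
  rewrite /s pearson_residual; congr Num.sqrt; apply: eq_bigr => i _.
  by rewrite /v expr_div_n mean_sqr.
apply: sum_sqr_perturb; first by rewrite mulr_ge0.
move=> i; rewrite /e normrM normfV (gtr0_norm (rm i)) ler_pdivrMr//.
apply: (le_trans (residual_err i)); rewrite -mulrA ler_peMr//.
exact: mesh_mean.
Qed.

(** Rounding [y] changes [Q] by [O(mesh (1 + Q))], the local bound loses
    [O(mesh (1 + Q^2))], and [(1 + Q^2) exp (- Q / 2)] is
    [O(exp (- Q / 4))]. *)
Lemma bulk_density_le : normal_cst n p * expR (- (Q / 2)) <=
  multinomial_pmf n p k + cell_cst R d * sigma * (normal_cst n p * expR (- (Q / 4))).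
Proof.
have c0 : 0 < normal_cst n p.
  by apply: normal_cst_gt0; [|exact: coord_gt0|exact: last_coord_gt0].
have := @multinomial_pmf_ge R d n p n0 p0 k floor_sum_le count_bulk.
pose t := Num.sqrt (pearson_tuple n p (natr_tuple k)).
have t0 : 0 <= t by exact: sqrtr_ge0.
have tE : t ^+ 2 = pearson_tuple n p (natr_tuple k) by rewrite sqr_sqrtr// pearson_ge0.
pose D : R := d.+1%:R; have D1 : 1 <= D by rewrite ler1n.
have dd0 : 0 <= d%:R :> R by [].
pose del := D * (d%:R * sigma).
have del0 : 0 <= del by rewrite !mulr_ge0// (le_trans ler01).
have ts : t <= s + del.
  rewrite -(@ler_pXn2r _ 2)// ?nnegrE ?addr_ge0//.
  by rewrite tE; exact: pearson_floor_le.
have -> : \sum_i count_residual n p k i ^+ 2 / category_mean n p i = t ^+ 2.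
  by rewrite tE pearson_residual; apply: eq_bigr => i _; rewrite residual_count// floor_sum_le.
set E := \sum_i local_error _ _.
have HE : E <= D * (2 * sigma * (1 + t ^+ 4)).
  apply: (@le_trans _ _ (\sum_(i < d.+1) (2 * sigma * (1 + t ^+ 4)))).
    apply: ler_sum => i _; apply: local_error_le => //.
    - exact: mesh_mean.
    - by apply: le_trans mesh_quarter _; lra.
    - by rewrite -residual_count ?floor_sum_le//; exact: residual_le.
  by rewrite sumr_const card_ord -[leLHS]mulr_natl.
have del1 : del <= 1 by exact: mesh_small.
pose eta := sigma * (1 + Q ^+ 2) * (D * (18 + 2 * d%:R)).
have QE : Q = s ^+ 2 by rewrite sqr_sqrtr// pearson_ge0.
have Heta : 2^-1 * t ^+ 2 + E <= Q / 2 + eta.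
  have t4 : 1 + t ^+ 4 <= 9 * (1 + s ^+ 4).
    have ts1 : t <= s + 1 by lra.
    have : t ^+ 4 <= (s + 1) ^+ 4 by rewrite lerXn2r// nnegrE addr_ge0.
    suff : (s + 1) ^+ 4 <= 8 * (s ^+ 4 + 1) by have := exprn_ge0 4 s0; lra.
    rewrite -subr_ge0 (_ : _ - _ = (s - 1) ^+ 2 * (7 * s ^+ 2 + 10 * s + 7)); last by ring.
    by rewrite mulr_ge0 ?sqr_ge0// !addr_ge0 ?mulr_ge0 ?sqr_ge0.
  have HE2 : E <= D * (18 * sigma * (1 + s ^+ 4)).
    apply: (le_trans HE); rewrite ler_wpM2l ?(le_trans ler01)//.
    have := ler_wpM2l sigma0 t4; nra.
  have Ht : t ^+ 2 <= s ^+ 2 + 4 * del * (1 + s ^+ 4).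
    have h : t ^+ 2 <= (s + del) ^+ 2 by rewrite lerXn2r// nnegrE addr_ge0.
    have h2 : s + 2^-1 <= 2 * (1 + s ^+ 4).
      have -> : s ^+ 4 = s ^+ 2 * s ^+ 2 by ring.
      have : 0 <= (s ^+ 2 - 2^-1) ^+ 2 by exact: sqr_ge0.
      have : 0 <= (s - 2^-1) ^+ 2 by exact: sqr_ge0.
      nra.
    have h3 := ler_wpM2l del0 h2; nra.
  have -> : eta = D * (18 * sigma * (1 + s ^+ 4)) + 2 * del * (1 + s ^+ 4).
    by rewrite /eta QE /del; ring.
  rewrite QE; lra.
move=> Hpmf; apply: (@le_trans _ _ (normal_cst n p * (expR (- (Q / 2)) * (1 - eta)) +
    cell_cst R d * sigma * (normal_cst n p * expR (- (Q / 4))))).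
  have h33 := @sqr_le_expR R Q (pearson_ge0 y).
  have eE : expR (- (Q / 2)) * expR (Q / 4) = expR (- (Q / 4)).
    by rewrite -expRD; congr expR; lra.
  have h : expR (- (Q / 2)) * eta <= cell_cst R d * sigma * expR (- (Q / 4)).
    rewrite -eE.
    have -> : cell_cst R d * sigma * (expR (- (Q / 2)) * expR (Q / 4)) =
      expR (- (Q / 2)) * (sigma * (33 * expR (Q / 4)) * (D * (18 + 2 * d%:R))).
      by rewrite /cell_cst -/D; ring.
    rewrite ler_wpM2l ?expR_ge0// ler_wpM2r//.
      by rewrite mulr_ge0 ?(le_trans ler01 D1)// addr_ge0// mulr_ge0.
    by rewrite ler_wpM2l.
  have := ler_wpM2l (ltW c0) h; nra.
rewrite lerD2r; apply: (le_trans _ Hpmf); rewrite ler_pM2l//.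
apply: (@le_trans _ _ (expR (- (Q / 2)) * expR (- eta))).
  by rewrite ler_wpM2l ?expR_ge0// (le_trans _ (expR_ge1Dx _)).
by rewrite -expRD ler_expR; lra.
Qed.

End bulk.

(** Outside the bulk [Q >= (4 mesh)^-2], so that [exp (- Q / 4) <= 16 mesh]. *)
Lemma tail_density_le (y : d.-tuple R) :
  1 < 2 * sigma * (Num.sqrt (pearson_tuple n p y) + 1) ->
  normal_cst n p * expR (- (pearson_tuple n p y / 2)) <=
  cell_cst R d * sigma * (normal_cst n p * expR (- (pearson_tuple n p y / 4))).
Proof.
set Q := pearson_tuple n p y; set s := Num.sqrt Q => h.
have c0 : 0 < normal_cst n p.
  by apply: normal_cst_gt0; [|exact: coord_gt0|exact: last_coord_gt0].
have QE : Q = s ^+ 2 by rewrite sqr_sqrtr// pearson_ge0.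
have s0 : 0 <= s by exact: sqrtr_ge0.
have hs : 1 <= 4 * sigma * s by have := mesh_quarter; lra.
have hQ : 1 <= 16 * sigma ^+ 2 * Q by rewrite QE; nra.
have e1 : Q / 4 <= expR (Q / 4) by have := expR_ge1Dx (Q / 4); lra.
have e0 := expR_gt0 (- (Q / 4)).
have eE : expR (- (Q / 4)) * expR (Q / 4) = 1 by rewrite -expRD addNr expR0.
have h16 : expR (- (Q / 4)) <= 16 * sigma.
  have : expR (- (Q / 4)) * (Q / 4) <= 1 by have := ler_wpM2l (ltW e0) e1; rewrite eE.
  have := mesh_quarter; have Q0 : 0 <= Q by exact: pearson_ge0.
  move=> q4 hh.
  have : expR (- (Q / 4)) <= 64 * sigma ^+ 2.
    have := ler_wpM2l (ltW e0) hQ; have := sqr_ge0 sigma; nra.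
  by have := sigma0; nra.
have -> : expR (- (Q / 2)) = expR (- (Q / 4)) * expR (- (Q / 4)).
  by rewrite -expRD; congr expR; lra.
rewrite mulrCA ler_wpM2r ?mulr_ge0 ?expR_ge0 ?(ltW c0)//.
apply: (le_trans h16); rewrite ler_wpM2r//.
rewrite /cell_cst; have : 1 <= d.+1%:R :> R by rewrite ler1n.
have : 0 <= d%:R :> R by [].
nra.
Qed.

End cell_comparison.

(** * One-sided Kolmogorov distance *)

Section lattice_cells.
Context {R : realType}.
Implicit Types (m : nat).

Definition cell_indic m (k : 'I_m -> nat) (y : m.-tuple R) : R :=
  \prod_(i < m) \1_(`[(k i)%:R, (k i)%:R + 1[%classic : set R) (tnth y i).

Lemma measurable_cell_indic m (k : 'I_m -> nat) :
  measurable_fun setT (cell_indic k).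
Proof.
apply: measurable_prod => i _; apply: measurableT_comp; last exact: measurable_tnth.
exact: measurable_indic.
Qed.

Lemma cell_indic_ge0 m (k : 'I_m -> nat) y : 0 <= cell_indic k y.
Proof. by apply: prodr_ge0. Qed.

Lemma iter_integral_cell m (k : 'I_m -> nat) :
  iter_integral (fun y => (cell_indic k y)%:E) = 1%E.
Proof.
elim: m k => [|m IH] k /=; first by rewrite /cell_indic big_ord0.
pose I0 : set R := `[(k ord0)%:R, (k ord0)%:R + 1[%classic.
transitivity (\int[lebesgue_measure]_x (\1_I0 x)%:E : \bar R)%E.
  apply: eq_integral => x _.
  under [X in iter_integral X]eq_fun => v.
    rewrite /cell_indic big_ord_recl (tnth_nth 0)/= EFinM.
    under eq_bigr => i _.
      rewrite (_ : tnth _ _ = tnth v i); last by rewrite !(tnth_nth 0)/=.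
      over.
    over.
  rewrite iter_integralZl ?lee_fin//.
  - by rewrite (IH (fun i => k (lift ord0 i))) mule1.
  - by apply/measurable_EFinP; exact: (measurable_cell_indic (fun i => k (lift ord0 i))).
  - by move=> v; rewrite lee_fin; exact: (cell_indic_ge0 (fun i => k (lift ord0 i))).
have mI0 : measurable I0 by exact: measurable_itv.
have -> : (\int[lebesgue_measure]_x (\1_I0 x)%:E = lebesgue_measure I0 :> \bar R)%E.
  rewrite (integral_indic lebesgue_measure measurableT mI0).
  by congr lebesgue_measure; exact: setIT.
rewrite /I0 lebesgue_measure_itv/= lte_fin ltrDl ltr01.
by rewrite -EFinB addrAC subrr add0r.
Qed.

End lattice_cells.

Section multinomial_sum.
Context {R : realType} {d : nat} {disp : measure_display}.
Context {Omega : measurableType disp} (P : probability Omega R).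

Lemma measurable_tuple_singleton (k : d.-tuple nat) : measurable [set k].
Proof.
rewrite (_ : [set k] = \bigcap_(i in [set: 'I_d])
    ((fun t : d.-tuple nat => tnth t i) @^-1` [set tnth k i])).
  apply: fin_bigcap_measurable; first exact: finite_finset.
  move=> i _; rewrite -[X in measurable X]setTI; exact: measurable_tnth.
apply/seteqP; split => [t -> i _ //|t /= H].
by apply/eq_from_tnth => i; exact: H.
Qed.

Lemma sum_singleton_le {d' : measure_display} {T : measurableType d'}
    (mu : {measure set T -> \bar R}) (I : eqType) (s : seq I) (f : I -> T)
    (A : set T) : injective f -> (forall i, measurable [set f i]) ->
  measurable A -> uniq s -> (forall i, i \in s -> A (f i)) ->
  (\sum_(i <- s) mu [set f i] <= mu A)%E.
Proof.
move=> injf mf; elim: s A => [|i s IH] A mA; first by rewrite big_nil.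
move=> /andP[/negP nis us] sA; rewrite big_cons.
have -> : A = [set f i] `|` (A `\ f i).
  apply/seteqP; split => x /=.
    by move=> Ax; have [->|] := EM (x = f i); [left|right].
  by move=> [->|[]//]; apply: sA; rewrite mem_head.
rewrite measureU//; last 2 first.
- exact: measurableD.
- by rewrite setDE setICA setICr setI0.
rewrite leeD2l//; apply: IH => //; first exact: measurableD.
move=> j js; split; first by apply: sA; rewrite inE js orbT.
by move=> /= /injf ji; apply: nis; rewrite -ji.
Qed.

Lemma multinomial_pmf_ge0 (n : nat) (p : 'cV[R]_d) (k : d.-tuple nat) :
  (forall i, 0 < full_coord p i) -> 0 <= multinomial_pmf n p k.
Proof.
move=> p0; rewrite /multinomial_pmf; case: ifPn => // _.
rewrite mulr_ge0 ?divr_ge0 ?prodr_ge0// => i _.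
by rewrite exprn_ge0// ltW.
Qed.

Variables (n : nat) (p : 'cV[R]_d) (K : {RV P >-> d.-tuple nat}).
Hypothesis multK : is_multinomial n p K.

Definition lattice_point (f : {ffun 'I_d -> 'I_n.+1}) : d.-tuple nat :=
  [tuple (f i : nat) | i < d].

Lemma lattice_point_inj : injective lattice_point.
Proof.
move=> f g fg; apply/ffunP => i; apply: val_inj => /=.
by have := congr1 (fun t => tnth t i) fg; rewrite !tnth_mktuple.
Qed.

Lemma sum_pmf_le_cdf L :
  (\sum_(f : {ffun 'I_d -> 'I_n.+1} | (pearson_tuple n p (natr_tuple (lattice_point f)) <= L)%R)
     (multinomial_pmf n p (lattice_point f))%:E
   <= cdf (pearson_RV n p (count_RV K)) L)%E.
Proof.
pose A := (pearson_tuple n p \o @natr_tuple R d) @^-1` `]-oo, L]%classic.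
have mA : measurable A.
  rewrite -[X in measurable X]setTI.
  have : measurable_fun setT (pearson_tuple n p \o @natr_tuple R d).
    by apply: measurableT_comp; [exact: measurable_pearson_tuple|exact: measurable_natr_tuple].
  by apply.
have -> : cdf (pearson_RV n p (count_RV K)) L = distribution P K A by [].
rewrite -big_filter; under eq_bigr do rewrite -multK.
apply: sum_singleton_le => //.
- exact: lattice_point_inj.
- by move=> f; exact: measurable_tuple_singleton.
- by rewrite filter_uniq// index_enum_uniq.
- by move=> f; rewrite mem_filter /A /= in_itv/= => /andP[].
Qed.

End multinomial_sum.

Section kolmogorov.
Context {R : realType} {d : nat} {disp : measure_display}.
Context {Omega : measurableType disp} (P : probability Omega R).
Variables (n : nat) (p : 'cV[R]_d) (tau : R) (K : {RV P >-> d.-tuple nat}).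
Hypothesis n0 : (0 < n)%N.
Hypothesis p0 : forall i, 0 < full_coord p i.
Hypothesis ptau : forall i, (full_coord p i)^-1 <= tau.
Local Notation sigma := (mesh n tau).
Local Notation del := (d.+1%:R * (d%:R * sigma)).
Hypothesis mesh_small : del <= 1.
Hypothesis mesh_quarter : sigma <= 4^-1.
Hypothesis multK : is_multinomial n p K.

Local Notation Q := (pearson_tuple n p).

(** With [del] the change of [sqrt Q] caused by rounding, the corner of the
    cell of any [y] in the smaller ellipsoid lies in the larger one. In the tail
    the second summand is enough. *)
Lemma density_le_cells (L : R) (y : d.-tuple R) : 0 <= L -> del <= Num.sqrt L ->
  \1_(Q @^-1` `]-oo, (Num.sqrt L - del) ^+ 2]%classic) y
    * (normal_cst n p * expR (- (Q y / 2))) <=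
  \sum_(f : {ffun 'I_d -> 'I_n.+1} | Q (natr_tuple (lattice_point f)) <= L)
     (multinomial_pmf n p (lattice_point f) * cell_indic (fun i => f i) y)
  + cell_cst R d * sigma * (normal_cst n p * expR (- (Q y / 4))).
Proof.
move=> L0 Ld.
have c0 : 0 < normal_cst n p.
  by apply: normal_cst_gt0; [|exact: coord_gt0|exact: last_coord_gt0].
have S0 : 0 <= \sum_(f : {ffun 'I_d -> 'I_n.+1} | Q (natr_tuple (lattice_point f)) <= L)
     (multinomial_pmf n p (lattice_point f) * cell_indic (fun i => f i) y).
  by apply: sumr_ge0 => f _; rewrite mulr_ge0 ?multinomial_pmf_ge0// cell_indic_ge0.
have E0 : 0 <= cell_cst R d * sigma * (normal_cst n p * expR (- (Q y / 4))).
  apply: mulr_ge0; first by rewrite mulr_ge0 ?cell_cst_ge0 ?sqrtr_ge0.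
  by rewrite mulr_ge0 ?expR_ge0// ltW.
rewrite indicE (_ : (y \in _) = (Q y <= (Num.sqrt L - del) ^+ 2)); last first.
  by apply/idP/idP; rewrite inE/= in_itv.
have [QL|_] := leP (Q y) _; last by rewrite mul0r addr_ge0.
rewrite mul1r.
have [bulk|tail] := leP (2 * sigma * (Num.sqrt (Q y) + 1)) 1; last first.
  have := tail_density_le n0 p0 mesh_quarter tail; lra.
apply: (le_trans (bulk_density_le n0 p0 ptau mesh_small mesh_quarter bulk)).
rewrite lerD2r.
have kn := floor_sum_le n0 p0 ptau mesh_small bulk.
have kjn j : (tnth (floor_tuple y) j < n.+1)%N.
  by rewrite ltnS (leq_trans _ kn)// (bigD1 j)//= leq_addr.
pose f := [ffun j => Ordinal (kjn j)].
have fk : lattice_point f = floor_tuple y.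
  by apply/eq_from_tnth => j; rewrite tnth_mktuple ffunE.
rewrite (bigD1 f)/=; last first.
  rewrite fk; apply: (le_trans (pearson_floor_le n0 p0 ptau mesh_small bulk)).
  rewrite -[leRHS](sqr_sqrtr L0) lerXn2r ?nnegrE ?sqrtr_ge0//.
    by rewrite addr_ge0 ?sqrtr_ge0// !mulr_ge0 ?sqrtr_ge0.
  rewrite -lerBrDr -(@ler_pXn2r _ 2)// ?nnegrE ?subr_ge0 ?sqrtr_ge0//.
  by rewrite sqr_sqrtr// (pearson_ge0 n0 p0).
have -> : cell_indic (fun i => f i) y = 1.
  apply: big1 => j _; rewrite indicE mem_setE in_itv/= ffunE/= tnth_mktuple.
  have /andP[-> h] := truncn_itv (bulk_ge0 n0 p0 ptau mesh_small bulk j).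
  by rewrite natr1 h.
rewrite mulr1 fk lerDl; apply: sumr_ge0 => g _.
by rewrite mulr_ge0 ?multinomial_pmf_ge0// cell_indic_ge0.
Qed.

Lemma chi2_cdf_le_multinomial (L : R) : 0 <= L -> del <= Num.sqrt L ->
  ((chi2_cdf d ((Num.sqrt L - del) ^+ 2))%:E <=
   cdf (pearson_RV n p (count_RV K)) L + (cell_cst R d * sigma * Num.sqrt 2 ^+ d)%:E)%E.
Proof.
move=> L0 Ld.
have pp := coord_gt0 p0; have rp := last_coord_gt0 p0.
have c0 : 0 < normal_cst n p by exact: normal_cst_gt0.
have e0 : 0 <= cell_cst R d * sigma.
  by rewrite mulr_ge0 ?sqrtr_ge0 ?cell_cst_ge0.
have mQ := @measurable_pearson_tuple R d n p.
have mg (a : R) : measurable_fun setT (fun y : d.-tuple R => normal_cst n p * expR (- (Q y / a))).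
  apply: measurable_funM => //; apply: measurableT_comp => //.
  by apply: measurableT_comp => //; exact: measurable_funM.
rewrite -(iter_integral_pearson_ray n0 pp rp).
pose W y := \sum_(f : {ffun 'I_d -> 'I_n.+1} | Q (natr_tuple (lattice_point f)) <= L)
     (multinomial_pmf n p (lattice_point f) * cell_indic (fun i => f i) y).
have mterm f : measurable_fun setT (fun y =>
    multinomial_pmf n p (lattice_point f)
      * @cell_indic R d (fun i => (f : {ffun 'I_d -> 'I_n.+1}) i) y).
  by apply: measurable_funM => //; exact: measurable_cell_indic.
have mW : measurable_fun setT W.
  rewrite /W; under eq_fun do rewrite -big_filter.
  by apply: measurable_sum.
apply: (@le_trans _ _ (iter_integral (fun y => (W y)%:E +
   (cell_cst R d * sigma)%:E * (normal_cst n p * expR (- (Q y / 4)))%:E)%E)).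
  apply: le_iter_integral.
  - apply/measurable_EFinP; apply: measurable_funM => //.
    apply: measurable_indic; rewrite -[X in measurable X]setTI; exact: mQ.
  - apply: emeasurable_funD; first exact/measurable_EFinP.
    by apply: measurable_funeM; apply/measurable_EFinP.
  - by move=> y; rewrite lee_fin !mulr_ge0 ?expR_ge0 ?(ltW c0).
  - by move=> y; rewrite -EFinM -EFinD lee_fin; exact: density_le_cells.
rewrite iter_integralD; last 4 first.
- exact/measurable_EFinP.
- by apply: measurable_funeM; apply/measurable_EFinP.
- move=> y; rewrite lee_fin; apply: sumr_ge0 => f _.
  by rewrite mulr_ge0 ?multinomial_pmf_ge0// cell_indic_ge0.
- by move=> y; rewrite mule_ge0 ?lee_fin// mulr_ge0 ?expR_ge0 ?(ltW c0).
rewrite iter_integralZl ?lee_fin//; last 2 first.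
- by apply/measurable_EFinP.
- by move=> y; rewrite lee_fin mulr_ge0 ?expR_ge0 ?(ltW c0).
rewrite (iter_integral_pearson_quarter n0 pp rp) -EFinM leeD2r//.
apply: le_trans (sum_pmf_le_cdf multK L).
rewrite -big_filter.
under [X in iter_integral X]eq_fun do rewrite /W -sumEFin -big_filter.
rewrite iter_integral_sum; last 2 first.
- by move=> f; apply/measurable_EFinP.
- by move=> f y; rewrite lee_fin mulr_ge0 ?multinomial_pmf_ge0// cell_indic_ge0.
apply: lee_sum => f _.
under [X in iter_integral X]eq_fun do rewrite EFinM.
rewrite iter_integralZl ?lee_fin ?multinomial_pmf_ge0//.
- by rewrite iter_integral_cell mule1.
- by apply/measurable_EFinP; exact: measurable_cell_indic.
- by move=> y; rewrite lee_fin cell_indic_ge0.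
Qed.

End kolmogorov.

(** * Shape of the chi-squared density *)

Section chi2_shape.
Context {R : realType}.
Variable d : nat.
Hypothesis d0 : (0 < d)%N.

Local Notation kappa := (@chi2_cst R d).
Local Notation dens := (@chi2_density R d).

Let kappa_gt0 : 0 < kappa. Proof. exact: chi2_cst_gt0. Qed.
Let half_gt0 : 0 < d%:R / 2 :> R. Proof. by rewrite divr_gt0// ltr0n. Qed.

Lemma chi2_density_gt0 l : 0 < l -> 0 < dens l.
Proof.
move=> l0; rewrite /chi2_density; apply: mulr_gt0.
  by apply: mulr_gt0 => //; exact: expR_gt0.
by apply: mulr_gt0 => //; exact: powR_gt0.
Qed.

(** The logarithmic derivative [(d/2 - 1) / l - 1/2] is nonpositive beyond the
    mode. For [d = 1] the mode is negative and the density decreases everywhere. *)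
Lemma chi2_density_nonincreasing x y : 0 < x -> x <= y -> 2 * (d%:R / 2 - 1) <= x ->
  dens y <= dens x.
Proof.
move=> x0 xy lox; have y0 : 0 < y by exact: lt_le_trans xy.
set s1 := d%:R / 2 - 1 in lox.
have E z : 0 < z -> dens z = kappa * (d%:R / 2) * expR (s1 * ln z - z / 2).
  move=> z0; rewrite /chi2_density -/s1 expRD /powR gt_eqF//; ring.
rewrite (E y)// (E x)//; apply: ler_wpM2l.
  by apply: mulr_ge0; exact: ltW.
rewrite ler_expR.
(* For s1 > 0, use ln (y / x) <= (y - x) / x and 2 (d/2 - 1) <= x. *)
suff : s1 * (ln y - ln x) <= (y - x) / 2 by lra.
have lnyx : 0 <= ln y - ln x by rewrite subr_ge0 ler_ln ?posrE.
have [s0|s0] := leP s1 0.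
  by apply: (@le_trans _ _ 0); [rewrite mulr_le0_ge0|rewrite divr_ge0// subr_ge0].
have h : ln y - ln x <= (y - x) / x.
  rewrite -ln_div ?posrE// -[leRHS]expRK ler_ln ?posrE ?divr_gt0 ?expR_gt0//.
  apply: le_trans (expR_ge1Dx _).
  by rewrite mulrBl divff ?gt_eqF// addrCA subrr addr0.
apply: (le_trans (ler_wpM2l (ltW s0) h)).
rewrite mulrCA ler_wpM2l ?subr_ge0// ler_pdivrMr//; lra.
Qed.

Lemma power_le_fact_expR (n : nat) (x : R) : 0 <= x -> x ^+ n <= n`!%:R * expR x.
Proof.
move=> x0; case: n => [|n].
  rewrite expr0 fact0 mul1r; apply: le_trans (expR_ge1Dx _); lra.
have f0 : 0 < (n.+1)`!%:R :> R by rewrite ltr0n fact_gt0.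
rewrite -ler_pdivrMl// mulrC; apply: le_trans (expR_ge1Dxn n x0); lra.
Qed.

Lemma mul_chi2_density l : 0 < l ->
  l * dens l = kappa * (d%:R / 2) * (Num.sqrt l ^+ d * expR (- (l / 2))).
Proof.
move=> l0; rewrite /chi2_density sqrtX_powR ?ltW// -(@mulr_powRB1 _ l (d%:R / 2)) ?ltW//.
by ring.
Qed.

(** Where [l G'(l) <= a] the function [c] is nonpositive; this and the next lemma
    locate such [l] at both ends of the half line. *)
Lemma mul_chi2_density_at0 (a : R) : 0 < a -> exists2 l, 0 < l & l * dens l <= a.
Proof.
move=> a0; set k := kappa * (d%:R / 2).
have k0 : 0 < k by exact: mulr_gt0.
pose q := Num.min 1 (a / k).
have q0 : 0 < q by rewrite lt_min ltr01 divr_gt0.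
exists (q ^+ 2); first by rewrite exprn_gt0.
rewrite mul_chi2_density ?exprn_gt0// -/k sqrtr_sqr gtr0_norm//.
have q1 : q <= 1 by rewrite ge_min lexx.
have qa : k * q <= a by rewrite mulrC -ler_pdivlMr// ge_min lexx orbT.
apply: le_trans qa; rewrite ler_pM2l//.
apply: (@le_trans _ _ (q * 1)); last by rewrite mulr1.
apply: ler_pM; rewrite ?exprn_ge0 ?(ltW q0) ?expR_ge0//.
  by rewrite -(prednK d0) exprS ler_piMr ?(ltW q0)// exprn_ile1 ?(ltW q0).
by rewrite expR_le1 oppr_le0 divr_ge0// sqr_ge0.
Qed.

Lemma mul_chi2_density_aty (a : R) : 0 < a ->
  exists B, forall l, B <= l -> 0 < l -> l * dens l <= a.
Proof.
move=> a0; set k := kappa * (d%:R / 2).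
have k0 : 0 < k by exact: mulr_gt0.
pose C : R := k * (2 ^+ d.+1 * (d.+1)`!%:R).
have C0 : 0 < C by rewrite mulr_gt0// mulr_gt0 ?exprn_gt0// ltr0n fact_gt0.
exists (Num.max 1 (C / a)) => l; rewrite ge_max => /andP[l1 lC] l0.
rewrite mul_chi2_density// -/k.
have sl : Num.sqrt l ^+ d <= l ^+ d.
  rewrite lerXn2r ?nnegrE ?sqrtr_ge0 ?(ltW l0)//.
  rewrite -[leRHS](sqr_sqrtr (ltW l0)) expr2 ler_peMl ?sqrtr_ge0//.
  by rewrite -sqrtr1 ler_wsqrtr.
have := @power_le_fact_expR d.+1 (l / 2) (divr_ge0 (ltW l0) (ler0n _ _)).
rewrite expr_div_n ler_pdivrMr ?exprn_gt0// exprS => h.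
have le1 : expR (- (l / 2)) * expR (l / 2) = 1 by rewrite -expRD addNr expR0.
have e0 := expR_gt0 (- (l / 2)).
have h2 : l * (k * (l ^+ d * expR (- (l / 2)))) <= C.
  have -> : l * (k * (l ^+ d * expR (- (l / 2)))) = k * expR (- (l / 2)) * (l * l ^+ d) by ring.
  have -> : C = k * expR (- (l / 2)) * ((d.+1)`!%:R * expR (l / 2) * 2 ^+ d.+1).
    transitivity (C * (expR (- (l / 2)) * expR (l / 2))); first by rewrite le1 mulr1.
    by rewrite /C; ring.
  by rewrite ler_wpM2l// mulr_ge0// ltW.
apply: (@le_trans _ _ (k * (l ^+ d * expR (- (l / 2))))).
  by rewrite ler_pM2l// ler_pM2r.
rewrite -(ler_pM2l l0); apply: (le_trans h2).
by rewrite -ler_pdivrMr.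
Qed.

Lemma exprS_diff_le (n : nat) (x y : R) : 0 <= x -> x <= y ->
  y ^+ n.+1 - x ^+ n.+1 <= n.+1%:R * (y - x) * y ^+ n.
Proof.
move=> x0 xy; have y0 : 0 <= y by exact: le_trans xy.
elim: n => [|n IH]; first by rewrite !expr1 expr0 mulr1 mul1r.
have -> : y ^+ n.+2 - x ^+ n.+2 =
    y * (y ^+ n.+1 - x ^+ n.+1) + (y - x) * x ^+ n.+1 by rewrite 2!(exprS _ n.+1); ring.
have -> : n.+2%:R * (y - x) * y ^+ n.+1 =
    y * (n.+1%:R * (y - x) * y ^+ n) + (y - x) * y ^+ n.+1.
  by rewrite -[n.+2%:R]natr1 [y ^+ n.+1]exprS; ring.
apply: lerD; first exact: ler_wpM2l.
by rewrite ler_wpM2l ?subr_ge0// lerXn2r ?nnegrE.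
Qed.

Definition shell_cst : R := kappa * (d`!%:R * expR (3 / 2)).

Let expR32 : 1 <= expR (3 / 2) :> R.
Proof. by apply: le_trans (expR_ge1Dx _); rewrite lerDl divr_ge0. Qed.

Let kappa_le_shell : kappa <= shell_cst.
Proof.
rewrite /shell_cst ler_peMr ?(ltW kappa_gt0)// -[leLHS]mulr1 ler_pM//.
by rewrite ler1n fact_gt0.
Qed.

Lemma chi2_cdf_ball_le L del : 0 < L -> del <= 1 -> Num.sqrt L <= del ->
  chi2_cdf d L <= shell_cst * del.
Proof.
move=> L0 del1 Ld.
have s0 : 0 < Num.sqrt L by rewrite sqrtr_gt0.
apply: (le_trans (chi2_cdf_small d L0)); rewrite -sqrtX_powR ?(ltW L0)//.
apply: ler_pM; rewrite ?(ltW kappa_gt0) ?exprn_ge0 ?sqrtr_ge0//.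
apply: (le_trans _ Ld); rewrite -(prednK d0) exprS ler_piMr ?(ltW s0)//.
by rewrite exprn_ile1 ?(ltW s0)// (le_trans Ld).
Qed.

(** The square root of a chi-squared variable has a density proportional to
    [r^(d - 1) exp (- r^2 / 2)], which is bounded because
    [r^(d - 1) <= (d - 1)! exp r]. *)
Lemma chi2_cdf_shell_le L del : 0 < L -> 0 <= del -> del <= 1 -> del <= Num.sqrt L ->
  chi2_cdf d L <= chi2_cdf d ((Num.sqrt L - del) ^+ 2) + shell_cst * del.
Proof.
move=> L0 del0 del1 Ld.
have [r1|] := ltP 0 (Num.sqrt L - del); last first.
  move=> h; have := chi2_cdf_ge0 d ((Num.sqrt L - del) ^+ 2).
  have : chi2_cdf d L <= shell_cst * del by apply: chi2_cdf_ball_le => //; lra.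
  lra.
set r := Num.sqrt L - del in r1 *.
have LE : L = (r + del) ^+ 2 by rewrite /r subrK sqr_sqrtr// ltW.
have xy : r ^+ 2 <= L.
  have rd : r <= r + del by rewrite lerDl.
  by rewrite LE; apply: lerXn2r => //; rewrite nnegrE ?(ltW r1)// addr_ge0// ltW.
have rd0 : 0 < r + del by rewrite ltr_wpDr.
have /andP[_] := chi2_cdf_slab d (exprn_gt0 2 r1) xy.
rewrite -!sqrtX_powR ?sqr_ge0 ?(ltW L0)// LE !sqrtr_sqr (gtr0_norm r1) (gtr0_norm rd0).
suff : kappa * expR (- (r ^+ 2 / 2)) * ((r + del) ^+ d - r ^+ d) <= shell_cst * del by lra.
have h1 : (r + del) ^+ d - r ^+ d <= d%:R * del * (r + del) ^+ d.-1.
  have := @exprS_diff_le d.-1 r (r + del) (ltW r1).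
  rewrite prednK// (_ : r + del - r = del); last by ring.
  by apply; rewrite lerDl.
have h2 : expR (- (r ^+ 2 / 2)) * (r + del) ^+ d.-1 <= (d.-1)`!%:R * expR (3 / 2).
  have := @power_le_fact_expR d.-1 (r + del) (addr_ge0 (ltW r1) del0).
  move=> /(ler_wpM2l (expR_ge0 (- (r ^+ 2 / 2)))) /le_trans; apply.
  rewrite mulrCA ler_wpM2l// -expRD ler_expR.
  have := sqr_ge0 (r - 1); nra.
suff /(ler_wpM2l (ltW kappa_gt0)) : expR (- (r ^+ 2 / 2)) * ((r + del) ^+ d - r ^+ d)
    <= d`!%:R * (expR (3 / 2) * del) by rewrite /shell_cst; lra.
apply: (le_trans (ler_wpM2l (expR_ge0 _) h1)).
have -> : d`! = (d * (d.-1)`!)%N by rewrite -{1 2}(prednK d0) factS prednK.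
have -> : expR (- (r ^+ 2 / 2)) * (d%:R * del * (r + del) ^+ d.-1) =
  d%:R * del * (expR (- (r ^+ 2 / 2)) * (r + del) ^+ d.-1) by ring.
have -> : (d * (d.-1)`!)%:R * (expR (3 / 2) * del) =
  d%:R * del * ((d.-1)`!%:R * expR (3 / 2)) :> R by rewrite natrM; ring.
by rewrite ler_wpM2l// mulr_ge0.
Qed.

(** The mean value theorem and the monotonicity of the density. As [chi2_cdf]
    may fail to be differentiable at 0, the theorem is applied between
    [y] and a point [z] slightly larger than [x]. *)
Lemma chi2_cdf_concave x y : 0 <= x -> 2 * (d%:R / 2 - 1) <= x -> x < y ->
  dens y * (y - x) <= chi2_cdf d y - chi2_cdf d x.
Proof.
move=> x0 lox xy; have y0 : 0 < y by exact: le_lt_trans xy.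
have H z : x < z -> z < y -> dens y * (y - z) <= chi2_cdf d y - chi2_cdf d x.
  move=> xz zy; have z0 : 0 < z by exact: le_lt_trans xz.
  apply: (@le_trans _ _ (chi2_cdf d y - chi2_cdf d z)); last first.
    by rewrite lerD2l lerN2 chi2_cdf_nd// ltW.
  have [|||c] := @MVT_segment _ (chi2_cdf d) dens z y.
  - exact: ltW.
  - move=> c; rewrite in_itv/= => /andP[zc _]; apply: is_derive_chi2_cdf.
    exact: lt_trans zc.
  - apply: derivable_within_continuous => c; rewrite in_itv/= => /andP[zc _].
    by have [] := is_derive_chi2_cdf d (lt_le_trans z0 zc).
  - rewrite in_itv/= => /andP[zc cy] ->; rewrite ler_wpM2r ?subr_ge0 ?(ltW zy)//.
    apply: chi2_density_nonincreasing => //; first exact: lt_le_trans zc.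
    by apply: (le_trans lox); apply: (le_trans (ltW xz)).
apply/ler_addgt0Pr => e e0.
have D0 := chi2_density_gt0 y0.
pose h := Num.min (e / dens y) ((y - x) / 2).
have h0 : 0 < h by rewrite lt_min !divr_gt0// subr_gt0.
have h1 : h <= (y - x) / 2 by rewrite ge_min lexx orbT.
have h2 : dens y * h <= e by rewrite mulrC -ler_pdivlMr// ge_min lexx.
have := H (x + h); nra.
Qed.

End chi2_shape.

Definition kolmogorov_cst (R : realType) (d : nat) : R :=
  cell_cst R d * Num.sqrt 2 ^+ d + shell_cst d * (d.+1%:R * d%:R).

Lemma kolmogorov_cst_ge0 (R : realType) (d : nat) : 0 <= kolmogorov_cst R d.
Proof.
have cell0 := cell_cst_ge0 R d.
have shell0 : 0 <= @shell_cst R d.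
  by rewrite /shell_cst mulr_ge0 ?chi2_cst_ge0// mulr_ge0// expR_ge0.
by apply: addr_ge0; apply: mulr_ge0 => //; rewrite ?exprn_ge0.
Qed.

Section kolmogorov_distance.
Context {R : realType} {d : nat} {disp : measure_display}.
Context {Omega : measurableType disp} (P : probability Omega R).
Hypothesis d0 : (0 < d)%N.
Variables (n : nat) (p : 'cV[R]_d) (tau : R) (K : {RV P >-> d.-tuple nat}).

Lemma chi2_cdf_le_multinomial_cdf L :
  (0 < n)%N -> (forall i, 0 < full_coord p i) ->
  (forall i, (full_coord p i)^-1 <= tau) ->
  d.+1%:R * (d%:R * mesh n tau) <= 1 -> mesh n tau <= 4^-1 ->
  is_multinomial n p K -> 0 < L ->
  ((chi2_cdf d L)%:E <=
   cdf (pearson_RV n p (count_RV K)) L + (kolmogorov_cst R d * mesh n tau)%:E)%E.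
Proof.
move=> n0 p0 ptau ms mq mK L0.
set del := d.+1%:R * (d%:R * mesh n tau) in ms *.
have del0 : 0 <= del by rewrite !mulr_ge0 ?sqrtr_ge0.
have -> : kolmogorov_cst R d * mesh n tau =
    cell_cst R d * mesh n tau * Num.sqrt 2 ^+ d + shell_cst d * del.
  by rewrite /kolmogorov_cst /del; ring.
have cc0 : 0 <= cell_cst R d * mesh n tau * Num.sqrt 2 ^+ d.
  apply: mulr_ge0; last exact: exprn_ge0 (sqrtr_ge0 _).
  by apply: mulr_ge0; [exact: cell_cst_ge0|exact: sqrtr_ge0].
have [Ld|Ld] := leP del (Num.sqrt L).
  rewrite EFinD addeA.
  apply: (@le_trans _ _ ((chi2_cdf d ((Num.sqrt L - del) ^+ 2))%:E + (shell_cst d * del)%:E)%E).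
    by rewrite -EFinD lee_fin; exact: chi2_cdf_shell_le.
  by rewrite leeD2r//; apply: chi2_cdf_le_multinomial => //; exact: ltW.
apply: (@le_trans _ _ (shell_cst d * del)%:E).
  by rewrite lee_fin; apply: chi2_cdf_ball_le => //; exact: ltW.
rewrite -[leLHS]add0e; apply: leeD; first exact: cdf_ge0.
by rewrite lee_fin lerDr.
Qed.

End kolmogorov_distance.

(** * Threshold and implicit equation *)

Section threshold.
Context {R : realType}.
Variables (d : nat) (tau : R).
Hypothesis d0 : (0 < d)%N.
Hypothesis htau : d.+1%:R <= tau.

Lemma Ptau_full_coord (p : 'cV[R]_d) : Ptau tau p ->
  (forall i, 0 < full_coord p i) /\ (forall i, (full_coord p i)^-1 <= tau).
Proof.
move=> [[p01 sp] pmax]; split=> i.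
  rewrite /full_coord; case: unlift => [j|]; first by have /andP[] := p01 j.
  by rewrite subr_gt0.
by apply: le_trans pmax; exact: (le_bigmax _ (fun i => (full_coord p i)^-1)).
Qed.

Definition kolmogorov_bound (n : nat) : R :=
  126 / 100 * tau ^+ 3 * d.+1%:R * ln n%:R `^ (3 / 2) / Num.sqrt n%:R.

Lemma error_termE n l : 0 < l ->
  error_term d tau n l = kolmogorov_bound n / chi2_density d l.
Proof.
by move=> l0; rewrite /error_term chi2_pdfE// /kolmogorov_bound invfM; ring.
Qed.

Let tau1 : 1 <= tau.
Proof. by apply: le_trans htau; rewrite ler1n. Qed.

(** The first three conditions are those of the Kolmogorov bound and the fifth
    compares that bound with the numerator of the error term. The last one gives
    [c (d + 1) >= d], which keeps the supremum of [c] away from the boundary of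
    the half line. *)
Lemma threshold : exists n0 : nat, forall n : nat, (n0 <= n)%N ->
  [/\ (0 < n)%N, d.+1%:R * (d%:R * mesh n tau) <= 1, mesh n tau <= 4^-1 &
   0 < kolmogorov_bound n /\
   kolmogorov_cst R d * mesh n tau <= kolmogorov_bound n /\
   kolmogorov_bound n <= chi2_density d d.+1%:R].
Proof.
pose A : R := 126 / 100 * tau ^+ 3 * d.+1%:R.
pose D : R := d.+1%:R * d%:R.
pose g : R := chi2_density d d.+1%:R.
have tau0 : 0 < tau by exact: lt_le_trans tau1.
have A0 : 0 < A by rewrite !mulr_gt0 ?exprn_gt0// ltr0n.
have g0 : 0 < g by exact: chi2_density_gt0.
have k0 := @kolmogorov_cst_ge0 R d.
set kol := kolmogorov_cst R d in k0 *.
(* With x = ln n, the inequality (x / 2)^3 <= 3! exp (x / 2) = 3! sqrt n gives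
   x^(3/2) / sqrt n <= x^2 / sqrt n <= 48 / x, so x >= 48 A / g suffices for the
   last condition. The other terms of B are read off the other conditions. *)
pose B : R := 1 + kol + D ^+ 2 * tau + 16 * tau + 48 * A / g.
have t1 : 0 <= D ^+ 2 * tau by rewrite mulr_ge0 ?sqr_ge0// ltW.
have t2 : 0 <= 48 * A / g by apply: divr_ge0; [apply: mulr_ge0 => //; exact: ltW|exact: ltW].
exists (Num.truncn (expR B)).+1 => n nn0.
have eBn : expR B <= n%:R.
  by apply: le_trans (ltW (truncnS_gt (expR B))) _; rewrite ler_nat.
have n0 : (0 < n)%N by exact: leq_ltn_trans nn0.
have nR : 0 < n%:R :> R by rewrite ltr0n.
have nB : B <= n%:R by apply: le_trans eBn; apply: le_trans (expR_ge1Dx _); lra.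
set x := ln (n%:R : R).
have xB : B <= x by rewrite -[leLHS]expRK ler_ln ?posrE ?expR_gt0.
have x1 : 1 <= x by rewrite /B in xB; lra.
have x0 : 0 < x by lra.
have sn0 : 0 < Num.sqrt n%:R :> R by rewrite sqrtr_gt0.
have m0 : 0 <= mesh n tau by exact: sqrtr_ge0.
have mE : mesh n tau ^+ 2 = tau / n%:R by rewrite sqr_sqrtr//; apply: divr_ge0; exact: ltW.
have D0 : 0 <= D by rewrite mulr_ge0.
have x32 : x `^ (3 / 2) <= x ^+ 2.
  by rewrite -powR_mulrn ?(ltW x0)// ler_powR//; lra.
have x32' : x <= x `^ (3 / 2) by rewrite le1r_powR//; lra.
have snE : Num.sqrt n%:R = expR (x / 2) :> R.
  by rewrite -powR12_sqrt ?(ltW nR)// expRM lnK ?posrE.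
split => //.
- rewrite mulrA -/D -(@ler_pXn2r _ 2)// ?nnegrE ?mulr_ge0// exprMn mE expr1n.
  rewrite mulrA ler_pdivrMr// mul1r; apply: le_trans nB; rewrite /B; lra.
- rewrite -(@ler_pXn2r _ 2)// ?nnegrE// mE ler_pdivrMr//.
  by rewrite /B in nB; lra.
- rewrite /kolmogorov_bound -/A -/x; split; [|split].
  + by rewrite divr_gt0// mulr_gt0// powR_gt0.
  + have -> : mesh n tau = Num.sqrt tau / Num.sqrt n%:R.
      by rewrite /mesh sqrtrM ?(ltW tau0)// sqrtrV ?(ltW nR).
    rewrite mulrA ler_pM2r ?invr_gt0//.
    have st : Num.sqrt tau <= tau ^+ 3.
      apply: (@le_trans _ _ tau).
        rewrite -[leRHS](sqr_sqrtr (ltW tau0)) expr2 ler_peMl ?sqrtr_ge0//.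
        by rewrite -sqrtr1 ler_wsqrtr.
      by rewrite exprS ler_peMr ?(ltW tau0)// exprn_ege1.
    have tA : tau ^+ 3 <= A.
      rewrite /A mulrAC ler_peMl ?exprn_ge0 ?(ltW tau0)//.
      have : 1 <= d.+1%:R :> R by rewrite ler1n.
      lra.
    have kx : kol <= x `^ (3 / 2) by apply: le_trans x32'; rewrite /B in xB; lra.
    rewrite [leRHS]mulrC; apply: ler_pM; rewrite ?sqrtr_ge0//.
    exact: le_trans tA.
  + rewrite -/g ler_pdivrMr//.
    have := @power_le_fact_expR R 3 (x / 2) (divr_ge0 (ltW x0) (ler0n _ _)).
    rewrite -snE (_ : (3`!)%:R = 6 :> R)// => h.
    have hx : 48 * A <= g * x.
      rewrite mulrC [g * x]mulrC -ler_pdivrMr// mulrC mulrAC -mulrA.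
      by rewrite mulrCA mulrA; rewrite /B in xB; lra.
    have h3 : x ^+ 3 <= 48 * Num.sqrt n%:R by rewrite expr_div_n in h; lra.
    rewrite -(ler_pM2l x0).
    apply: (@le_trans _ _ (A * x ^+ 3)).
      rewrite mulrCA ler_pM2l// exprS ler_pM2l//.
    have h4 : A * x ^+ 3 <= A * (48 * Num.sqrt n%:R) by rewrite ler_pM2l.
    apply: (le_trans h4).
    have := ler_wpM2r (ltW sn0) hx; lra.
Qed.

End threshold.

Section solve_c.
Context {R : realType}.
Variables (d : nat) (a : R).
Hypothesis d0 : (0 < d)%N.
Hypothesis a0 : 0 < a.
Hypothesis a_small : a <= chi2_density d d.+1%:R.

Local Notation g := (@chi2_density R d).
Local Notation c := (fun l : R => l - a / g l).

Let g0 (l : R) : 0 < l -> 0 < g l. Proof. exact: chi2_density_gt0. Qed.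

Let c_continuous (l : R) : 0 < l -> {for l, continuous c}.
Proof.
move=> l0; apply: cvgB; first exact: cvg_id.
apply: cvgM; first exact: cvg_cst.
apply: cvgV; first by rewrite gt_eqF// g0.
exact: chi2_density_continuous.
Qed.

Let c_within (x y : R) : 0 < x -> {within `[x, y], continuous c}.
Proof.
move=> x0; apply: continuous_in_subspaceT => z; rewrite inE/= in_itv/= => /andP[xz _].
by apply: c_continuous; exact: lt_le_trans xz.
Qed.

Let c_le0 (l : R) : 0 < l -> l * g l <= a -> c l <= 0.
Proof. by move=> l0 h; rewrite subr_le0 ler_pdivlMr// g0. Qed.

(** Below [d] the value [c l] is less than [d], far out it is nonpositive, and
    [c (d + 1) >= d]; so the supremum is that of [c] on a compact interval. *)
Lemma c_attains_sup : exists2 l, 0 < l & forall x, 0 < x -> c x <= c l.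
Proof.
have [B HB] := mul_chi2_density_aty d0 a0.
pose b := Num.max B d.+1%:R.
have dR : 0 < d%:R :> R by rewrite ltr0n.
have db : d%:R <= b by rewrite le_max ler_nat leqnSn orbT.
have [l lI lmax] := EVT_max db (@c_within _ b dR).
have l0 : 0 < l by move: lI; rewrite in_itv/= => /andP[h _]; exact: lt_le_trans h.
exists l => // x x0.
have cd1 : d%:R <= c d.+1%:R.
  have : a / g d.+1%:R <= 1 by rewrite ler_pdivrMr ?g0// mul1r.
  by rewrite -[X in _ -> _ <= X - _]natr1; lra.
have cl : d%:R <= c l.
  apply: (le_trans cd1); apply: lmax; rewrite in_itv/= ler_nat leqnSn/=.
  by rewrite le_max lexx orbT.
have [xd|dx] := ltP x d%:R.
  by apply: le_trans cl; apply: ltW; apply: le_lt_trans xd; rewrite gerBl divr_ge0 ?ltW ?g0.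
have [xb|bx] := leP x b; first by apply: lmax; rewrite in_itv/= dx.
apply: (@le_trans _ _ 0); last by apply: le_trans cl.
apply: c_le0 => //; apply: HB => //.
by apply: ltW; apply: le_lt_trans bx; rewrite le_max lexx.
Qed.

(** The intermediate value theorem, between the given point and one close to 0
    where [c] is nonpositive. *)
Lemma c_solvable (y : R) : 0 <= y -> (exists2 l, 0 < l & y <= c l) ->
  exists2 l, 0 < l & y = c l.
Proof.
move=> y0 [l1 l10 yl1].
have [l2 l20 h2] := mul_chi2_density_at0 d0 a0.
have yl2 : c l2 <= y by apply: le_trans y0; exact: c_le0.
have [l12|l21] := leP l1 l2.
  have [|l lI <-] := IVT l12 (@c_within _ l2 l10) (v := y).
    by rewrite ge_min le_max yl1 yl2 orbT.
  exists l => //; move: lI; rewrite in_itv/= => /andP[h _]; exact: lt_le_trans h.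
have [|l lI <-] := IVT (ltW l21) (@c_within _ l1 l20) (v := y).
  by rewrite ge_min le_max yl1 yl2 orbT.
exists l => //; move: lI; rewrite in_itv/= => /andP[h _]; exact: lt_le_trans h.
Qed.

End solve_c.

Unset Implicit Arguments.

Theorem corollary2p8 (R : realType) (d : nat) (hd : (0 < d)%N)
    (tau : R) (htau : d.+1%:R <= tau) :
  exists n0 : nat, forall n : nat, (n0 <= n)%N ->
  forall p : 'cV[R]_d, Ptau tau p ->
  forall (disp : measure_display) (Omega : measurableType disp)
    (P : probability Omega R)
    (K : {RV P >-> d.-tuple nat}) (Y : {RV P >-> d.-tuple R}),
  is_multinomial n p K ->
  is_mvnormal (n%:R *: p) (n%:R *: Sigma p) Y ->
  let QK : {RV P >-> R} := pearson_RV n p (count_RV K) in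
  let QY : {RV P >-> R} := pearson_RV n p Y in
  let F : R -> \bar R := cdf QK in
  let G : R -> \bar R := cdf QY in
  let Xi : Omega -> \bar R := fun w => quantile F (G (QY w)) in
  let lo : R := 2 * (d%:R / 2 - 1) in
  let csup : \bar R :=
    ereal_sup [set (c_fun d tau n l)%:E | l in [set l : R | lo <= l /\ 0 < l]] in
  let A : set Omega := [set w | lo <= QY w /\ ((QY w)%:E <= csup)%E] in
  (forall l : R, 0 < l -> is_derive l 1 (fun x : R => fine (G x)) (chi2_pdf d l))
  /\
  (forall w : Omega, A w ->
     (exists L : R, 0 < L /\ QY w = c_fun d tau n L) /\
     (forall L : R, 0 < L -> QY w = c_fun d tau n L ->
        (Xi w <= (QY w + error_term d tau n L)%:E)%E)).
Proof.
have [n0 thr] := threshold hd htau.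
exists n0 => n nn0 p pP disp Omega P K Y mK nY QK QY F G Xi lo csup A.
have [npos ms mq [a0 [ka ag]]] := thr n nn0.
have [p0 ptau] := Ptau_full_coord pP.
set a := kolmogorov_bound d tau n in a0 ka ag.
have GE x : G x = (chi2_cdf d x)%:E.
  by apply: cdf_pearson_normal => //; [exact: coord_gt0|exact: last_coord_gt0].
have cE l : 0 < l -> c_fun d tau n l = l - a / chi2_density d l.
  by move=> l0; rewrite /c_fun error_termE.
split=> [l l0|w [low wsup]].
  rewrite chi2_pdfE// (_ : (fun x => fine (G x)) = chi2_cdf d); last first.
    by apply/funext => x; rewrite GE.
  exact: is_derive_chi2_cdf.
have y0 : 0 <= QY w by exact: (pearson_ge0 npos p0).
split.
  have [l l0 lmax] := c_attains_sup hd a0 ag.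
  have [|L L0 yL] := c_solvable hd a0 y0; last by exists L; rewrite cE.
  exists l => //; rewrite -lee_fin; apply: (le_trans wsup).
  apply: ge_ereal_sup => _ [x [_ x0] <-].
  by rewrite cE// lee_fin; exact: lmax.
move=> L L0; rewrite cE// => yL.
have D0 := chi2_density_gt0 hd L0.
have -> : QY w + error_term d tau n L = L.
  by rewrite error_termE// -/a yL subrK.
have yltL : QY w < L by rewrite yL gtrBl divr_gt0.
apply: ereal_inf_lbound; exists L => //=.
rewrite GE.
have := chi2_cdf_concave hd y0 low yltL.
have -> : chi2_density d L * (L - QY w) = a by rewrite {1}yL; field; rewrite gt_eqF.
move=> h.
have := chi2_cdf_le_multinomial_cdf hd npos p0 ptau ms mq mK L0.
rewrite -/QK -/F => h2.
have Ffin : F L \is a fin_num by exact: fin_num_measure.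
rewrite -(fineK Ffin) -EFinD lee_fin in h2.
rewrite -(fineK Ffin) lee_fin; lra.
Qed.
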